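(* Let $d\ge 1$ and let $\mathcal{UN}_d^{\mathbb{R}}\subset\mathbb{R}^{d\times d}$ be the space of real normal $d\times d$ matrices of Frobenius norm $1$. Then $\mathcal{UN}_d^{\mathbb{R}}$ is $k$-connected for all $k\le d-2$; that is, $\pi_k(\mathcal{UN}_d^{\mathbb{R}},x_0)$ is trivial for every integer $0\le k\le d-2$ and every basepoint $x_0$.
   Context: A real matrix $A$ is normal if $AA^T=A^TA$. The Frobenius norm is $\|B\|=\big(\sum_{i,j}b_{ij}^2\big)^{1/2}$. $\mathcal{UN}_d^{\mathbb{R}}=\{A\in\mathbb{R}^{d\times d}: AA^T=A^TA,\ \|A\|=1\}$ carries the subspace topology. The convention used is that a space $\mathcal{X}$ is called $k$-connected if its $k$th homotopy group $\pi_k(\mathcal{X},x_0)$ is trivial; triviality of $\pi_0$ means path-connectedness. *)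

(* Defs.v *)
From HB Require Import structures.
From mathcomp Require Import all_boot all_order all_algebra.
From mathcomp Require Import all_classical all_reals all_analysis.

Set Implicit Arguments.
Unset Strict Implicit.
Unset Printing Implicit Defensive.

Import Order.TTheory GRing.Theory Num.Theory.
Import numFieldNormedType.Exports.

Local Open Scope classical_set_scope.
Local Open Scope ring_scope.

Definition frobenius_norm (R : realType) (m n : nat) (A : 'M[R]_(m, n)) : R :=
  Num.sqrt (\sum_(i < m) \sum_(j < n) A i j ^+ 2).

Definition real_normal (R : realType) (d : nat) (A : 'M[R]_d) : Prop :=
  A *m A^T = A^T *m A.

(* The canonical topology of the type [set_type (UN R d)] is
   the initial topology of the inclusion, i.e. the subspace topology. *)
Definition UN (R : realType) (d : nat) : set 'M[R]_d :=
  [set A | real_normal A /\ frobenius_norm A = 1].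
Arguments UN : clear implicits.

(* For k = 0 the cube is a single point and its boundary is empty. *)
Definition cube (R : realType) (k : nat) : set 'rV[R]_k :=
  [set s | forall i, 0 <= s ord0 i <= 1].
Arguments cube : clear implicits.

Definition cube_boundary (R : realType) (k : nat) : set 'rV[R]_k :=
  [set s | cube R k s /\ exists i, s ord0 i = 0 \/ s ord0 i = 1].
Arguments cube_boundary : clear implicits.

(* Maps (I^k, bd I^k) -> (X, x0). They are encoded as total functions on
   R^k of which only the values on the cube are constrained. *)
Definition spheroid (R : realType) (k : nat) (X : topologicalType) (x0 : X) :
    set ('rV[R]_k -> X) :=
  [set f | {within cube R k, continuous f} /\
           (forall s, cube_boundary R k s -> f s = x0)].

(* Homotopy through maps (I^k, bd I^k) -> (X, x0). *)
Definition homotopic (R : realType) (k : nat) (X : topologicalType) (x0 : X)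
    (f g : 'rV[R]_k -> X) : Prop :=
  exists H : R * 'rV[R]_k -> X,
    [/\ {within `[0, 1]%classic `*` cube R k, continuous H},
        forall s, cube R k s -> H (0, s) = f s,
        forall s, cube R k s -> H (1, s) = g s &
        forall t s, 0 <= t <= 1 -> cube_boundary R k s -> H (t, s) = x0].

Definition homotopy_class (R : realType) (k : nat) (X : topologicalType)
    (x0 : X) (f : 'rV[R]_k -> X) : set ('rV[R]_k -> X) :=
  [set g | spheroid x0 g /\ homotopic x0 f g].

(* The underlying set of pi_k(X, x0). The group law is not needed: for k >= 1
   the group is trivial iff this set contains only the class of the constant
   map, and for k = 0 there is in general no group law. *)
Definition pi_ (R : realType) (k : nat) (X : topologicalType) (x0 : X) :
    set (set ('rV[R]_k -> X)) :=
  [set homotopy_class x0 f | f in spheroid x0].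
Arguments pi_ : clear implicits.

Definition pi_trivial (R : realType) (k : nat) (X : topologicalType)
    (x0 : X) : Prop :=
  pi_ R k X x0 = [set homotopy_class x0 (fun=> x0)].
Arguments pi_trivial : clear implicits.

(* Only the k-th homotopy group is constrained, not those of lower degree. *)
Definition k_connected (R : realType) (k : nat) (X : topologicalType) : Prop :=
  forall x0 : X, pi_trivial R k X x0.

(* Main.v *)
(* Normal matrices are exactly the critical points of A |-> |[A, A^T]|^2, and
   they are reached by flowing inside similarity classes: with M = [A, A^T] and
   N = [M, A], one step replaces A by g A g^-1 with g = 1 - M / 100.  A cut
   argument on the spectrum of M gives the Lojasiewicz inequality
   |M|^3 <= d^6 |N|^2, so the iteration converges uniformly on the unit ball.
   Its limit is a uniformly continuous retraction onto normal matrices, and it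
   vanishes only at nilpotent matrices because characteristic polynomials are
   preserved.  Nilpotent matrices are covered by finitely many polynomial images
   of R^(d (d - 1)), hence a homotopy depending on k + 1 < d parameters can be
   moved off them by a small perturbation; retracting and normalising then
   turns the straight-line homotopy between two spheroids into a homotopy
   inside the unit normal matrices. *)
Require Import Defs.
From mathcomp Require Import all_boot all_order all_algebra.
From mathcomp Require Import all_classical all_reals all_analysis.
From mathcomp Require Import ring lra complex zify.
Import Order.TTheory GRing.Theory Num.Theory.
Import numFieldNormedType.Exports.

Set Implicit Arguments.
Unset Strict Implicit.
Unset Printing Implicit Defensive.

Local Open Scope ring_scope.

(** * The flow on the unit ball *)

(** A step by conjugation keeps the characteristic polynomial exactly, so it survives in the limit;
    an additive gradient step would lose it. The constant 1/100 only has to make [step_conj]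
    invertible and the second-order terms small on the unit ball. The bound on k is a dimension
    count: the d (d - 1) parameters of the nilpotent matrices and the k + 1 of the homotopy together
    stay below d^2 exactly when k + 1 < d. Polynomial maps reduce avoidance to a count of monomials,
    without measure or smoothness; this is why the homotopy is approximated by a piecewise
    polynomial one. The obstacle is that a perturbation also moves the values prescribed on the
    boundary. A cutoff deals with it: the perturbation acts only where the retraction is small,
    whereas at a unit normal matrix, halved to leave room inside the unit ball, the retraction has
    norm 1/2. *)

Notation frob := frobenius_norm.

(** * The Frobenius norm as a Euclidean and submultiplicative norm *)

Section Frobenius.
Variable R : realType.

Definition frob_dot m n (A B : 'M[R]_(m, n)) : R :=
  \sum_(i < m) \sum_(j < n) A i j * B i j.

Lemma frob_dotE m n (A B : 'M[R]_(m, n)) : frob_dot A B = \tr (A *m B^T).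
Proof.
by apply: eq_bigr => i _; rewrite mxE; apply: eq_bigr => j _; rewrite mxE.
Qed.

Lemma frob_dotC m n (A B : 'M[R]_(m, n)) : frob_dot A B = frob_dot B A.
Proof. by apply: eq_bigr => i _; apply: eq_bigr => j _; rewrite mulrC. Qed.

Lemma frob_dotDl m n (A B C : 'M[R]_(m, n)) :
  frob_dot (A + B) C = frob_dot A C + frob_dot B C.
Proof. by rewrite !frob_dotE mulmxDl mxtraceD. Qed.

Lemma frob_dotZl m n (a : R) (A C : 'M[R]_(m, n)) :
  frob_dot (a *: A) C = a * frob_dot A C.
Proof. by rewrite !frob_dotE -scalemxAl mxtraceZ. Qed.

Lemma frob_dotDr m n (A B C : 'M[R]_(m, n)) :
  frob_dot A (B + C) = frob_dot A B + frob_dot A C.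
Proof. by rewrite frob_dotC frob_dotDl !(frob_dotC A). Qed.

Lemma frob_dotZr m n (a : R) (A C : 'M[R]_(m, n)) :
  frob_dot A (a *: C) = a * frob_dot A C.
Proof. by rewrite frob_dotC frob_dotZl frob_dotC. Qed.

Lemma frob_dot_ge0 m n (A : 'M[R]_(m, n)) : 0 <= frob_dot A A.
Proof. by do 2!(apply: sumr_ge0 => ? _); rewrite -expr2 sqr_ge0. Qed.

Lemma frob_ge0 m n (A : 'M[R]_(m, n)) : 0 <= frob A.
Proof. exact: sqrtr_ge0. Qed.

Lemma frob_sqr m n (A : 'M[R]_(m, n)) : frob A ^+ 2 = frob_dot A A.
Proof.
rewrite sqr_sqrtr; last by do 2!(apply: sumr_ge0 => ? _); rewrite sqr_ge0.
by apply: eq_bigr => i _; apply: eq_bigr => j _; rewrite expr2.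
Qed.

Lemma frob_sqr_add m n (A B : 'M[R]_(m, n)) :
  frob (A + B) ^+ 2 = frob A ^+ 2 + 2 * frob_dot A B + frob B ^+ 2.
Proof.
by rewrite !frob_sqr frob_dotDl !frob_dotDr (frob_dotC B A); ring.
Qed.

Lemma frob0 m n : frob (0 : 'M[R]_(m, n)) = 0.
Proof.
apply/eqP; rewrite -sqrf_eq0 frob_sqr; apply/eqP; apply: big1 => i _.
by apply: big1 => j _; rewrite mxE mul0r.
Qed.

Lemma frobZ m n (a : R) (A : 'M[R]_(m, n)) : frob (a *: A) = `|a| * frob A.
Proof.
apply/eqP; rewrite -(@eqrXn2 _ 2) ?mulr_ge0 ?frob_ge0 //.
by rewrite exprMn real_normK ?num_real // !frob_sqr frob_dotZl frob_dotZr mulrA.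
Qed.

Lemma frobN m n (A : 'M[R]_(m, n)) : frob (- A) = frob A.
Proof. by rewrite -scaleN1r frobZ normrN normr1 mul1r. Qed.

Lemma frob_distC m n (A B : 'M[R]_(m, n)) : frob (A - B) = frob (B - A).
Proof. by rewrite -frobN opprB. Qed.

Lemma frob_trmx m n (A : 'M[R]_(m, n)) : frob A^T = frob A.
Proof.
rewrite /frobenius_norm exchange_big /=; congr Num.sqrt.
by apply: eq_bigr => i _; apply: eq_bigr => j _; rewrite mxE.
Qed.

Lemma frob_entry m n (A : 'M[R]_(m, n)) i j : `|A i j| <= frob A.
Proof.
rewrite -(@ler_pXn2r _ 2) ?nnegrE ?frob_ge0 // real_normK ?num_real // frob_sqr.
rewrite /frob_dot (bigD1 i) //= (bigD1 j) //= -expr2 -addrA lerDl addr_ge0 //.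
  by apply: sumr_ge0 => ? _; rewrite -expr2 sqr_ge0.
by do 2!(apply: sumr_ge0 => ? _); rewrite -expr2 sqr_ge0.
Qed.

Lemma frob_eq0 m n (A : 'M[R]_(m, n)) : frob A = 0 -> A = 0.
Proof.
move=> A0; apply/matrixP => i j; rewrite mxE; apply/eqP.
by rewrite -normr_le0 -A0 frob_entry.
Qed.

(** Cauchy-Schwarz, from positivity of the form at <B, B> A - <A, B> B, a combination that avoids
    division. *)
Lemma frob_dot_sqr_le m n (A B : 'M[R]_(m, n)) :
  frob_dot A B ^+ 2 <= frob_dot A A * frob_dot B B.
Proof.
have [b0|b0] := ltrP 0 (frob_dot B B).
  have := frob_dot_ge0 (frob_dot B B *: A + (- frob_dot A B) *: B).
  rewrite frob_dotDl !frob_dotDr !frob_dotZl !frob_dotZr (frob_dotC B A).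
  set x := frob_dot A A; set y := frob_dot A B; set z := frob_dot B B in b0 *.
  have -> : z * (z * x) + z * (- y * y) + (- y * (z * y) + - y * (- y * z))
     = z * (x * z - y ^+ 2) by ring.
  by rewrite pmulr_rge0 // subr_ge0.
have -> : B = 0.
  apply: frob_eq0; apply/eqP; rewrite -sqrf_eq0 eq_le sqr_ge0 andbT.
  by rewrite frob_sqr.
rewrite -[in frob_dot A _](scale0r A) frob_dotZr mul0r expr0n /=.
by rewrite mulr_ge0 ?frob_dot_ge0.
Qed.

Lemma frob_CS m n (A B : 'M[R]_(m, n)) : `|frob_dot A B| <= frob A * frob B.
Proof.
rewrite -(@ler_pXn2r _ 2) ?nnegrE ?mulr_ge0 ?frob_ge0 //.
by rewrite real_normK ?num_real // exprMn !frob_sqr frob_dot_sqr_le.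
Qed.

Lemma frob_dot_le m n (A B : 'M[R]_(m, n)) : frob_dot A B <= frob A * frob B.
Proof. exact: le_trans (ler_norm _) (frob_CS _ _). Qed.

Lemma frobD m n (A B : 'M[R]_(m, n)) : frob (A + B) <= frob A + frob B.
Proof.
rewrite -(@ler_pXn2r _ 2) ?nnegrE ?addr_ge0 ?frob_ge0 // frob_sqr_add.
have := frob_dot_le A B; nra.
Qed.

Lemma frobB m n (A B : 'M[R]_(m, n)) : frob (A - B) <= frob A + frob B.
Proof. by rewrite -(frobN B) frobD. Qed.

Lemma frob_dist_triangle m n (B A C : 'M[R]_(m, n)) :
  frob (A - C) <= frob (A - B) + frob (B - C).
Proof. by rewrite -[A - C](subrKA B) frobD. Qed.

Lemma frob_sum m n I (r : seq I) (P : pred I) (F : I -> 'M[R]_(m, n)) :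
  frob (\sum_(i <- r | P i) F i) <= \sum_(i <- r | P i) frob (F i).
Proof.
elim/big_ind2: _ => [|x1 x2 y1 y2 h1 h2|//]; first by rewrite frob0.
exact: le_trans (frobD _ _) (lerD h1 h2).
Qed.

Lemma frobM m n p (A : 'M[R]_(m, n)) (B : 'M[R]_(n, p)) :
  frob (A *m B) <= frob A * frob B.
Proof.
rewrite -(@ler_pXn2r _ 2) ?nnegrE ?mulr_ge0 ?frob_ge0 // exprMn.
rewrite -(frob_trmx B) !frob_sqr /frob_dot big_distrl /=.
apply: ler_sum => i _; rewrite big_distrr /=; apply: ler_sum => j _.
have -> : (A *m B) i j * (A *m B) i j = frob_dot (row i A) (row j B^T) ^+ 2.
  rewrite expr2 /frob_dot big_ord1 mxE.
  by congr (_ * _); apply: eq_bigr => k _; rewrite !mxE.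
have -> : \sum_j0 A i j0 * A i j0 = frob_dot (row i A) (row i A).
  by rewrite /frob_dot big_ord1; apply: eq_bigr => k _; rewrite !mxE.
have -> : \sum_j0 B^T j j0 * B^T j j0 = frob_dot (row j B^T) (row j B^T).
  by rewrite /frob_dot big_ord1; apply: eq_bigr => k _; rewrite !mxE.
exact: frob_dot_sqr_le.
Qed.

Lemma frob_le_sum m n (A : 'M[R]_(m, n)) : frob A <= \sum_i \sum_j `|A i j|.
Proof.
rewrite {1}[A]matrix_sum_delta (le_trans (frob_sum _ _ _)) //.
apply: ler_sum => i _; rewrite (le_trans (frob_sum _ _ _)) //.
apply: ler_sum => j _; rewrite frobZ ler_piMr //.
rewrite -(@ler_pXn2r _ 2) ?nnegrE ?frob_ge0 // frob_sqr /frob_dot.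
rewrite (bigD1 i) //= (bigD1 j) //= !big1 => [|k ki|k kj].
- by rewrite !mxE !eqxx mulr1 !addr0 expr1n.
- by rewrite big1 // => l _; rewrite !mxE (negbTE ki) mul0r.
- by rewrite !mxE (negbTE kj) andbF mul0r.
Qed.

End Frobenius.

(** * One step of the flow: descent and Lipschitz estimates *)

Section Flow.
Variables (R : realType) (d : nat).
Implicit Types A B X Y : 'M[R]_d.

Let trB A B : \tr (A - B) = \tr A - \tr B.
Proof. by rewrite raddfB. Qed.

Definition comm A B := A *m B - B *m A.
(** Up to normalisation, the moment map of the conjugation action of the general linear group. *)
Definition moment A := comm A A^T.
(** A quarter of the gradient of |[A, A^T]|^2. Being a commutator with [A], it is tangent to the
    similarity class of [A]. *)
Definition grad A := comm (moment A) A.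

Lemma frob_comm A B : frob (comm A B) <= 2 * (frob A * frob B).
Proof.
apply: le_trans (frobB _ _) _.
have := frobM A B; have := frobM B A; lra.
Qed.

Lemma trmx_moment A : (moment A)^T = moment A.
Proof. by rewrite /moment /comm raddfB /= !trmx_mul trmxK. Qed.

(** Cyclicity of the trace turns <[M, A], A> into <M, [A, A^T]>. This pairing is the leading rate at
    which a step shrinks |A|^2. *)
Lemma frob_dot_grad A : frob_dot (grad A) A = frob (moment A) ^+ 2.
Proof.
rewrite frob_sqr !frob_dotE trmx_moment /grad.
have -> : \tr (moment A *m moment A) =
    \tr (moment A *m (A *m A^T)) - \tr (moment A *m (A^T *m A)).
  by rewrite -trB -mulmxBr.
move: (moment A) => M; rewrite /comm mulmxBl trB -!mulmxA; congr (_ - _).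
by rewrite mxtrace_mulC -mulmxA.
Qed.

Lemma momentD A X : moment (A + X) =
  moment A + (comm X A^T + comm A X^T + comm X X^T).
Proof.
rewrite /moment /comm [(A + X)^T]raddfD /= !(mulmxDl, mulmxDr).
by apply/matrixP=> i j; rewrite !mxE; ring.
Qed.

(** Together with the next lemma this computes the derivative of |moment|^2: each of the two linear
    terms in [momentD] pairs with [moment A] to <X, grad A>. *)
Lemma frob_dot_moment_l A X :
  frob_dot (moment A) (comm X A^T) = frob_dot X (grad A).
Proof.
rewrite [RHS]frob_dotC !frob_dotE /grad.
have -> : (comm X A^T)^T = A *m X^T - X^T *m A.
  by rewrite /comm raddfB /= !trmx_mul trmxK.
move: (moment A) => M.
rewrite /comm mulmxBr mulmxBl !trB -!mulmxA; congr (_ - _).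
by rewrite [RHS]mxtrace_mulC !mulmxA.
Qed.

Lemma frob_dot_moment_r A X :
  frob_dot (moment A) (comm A X^T) = frob_dot X (grad A).
Proof.
rewrite -frob_dot_moment_l !frob_dotE -[LHS]mxtrace_tr trmx_mul trmxK.
rewrite trmx_moment mxtrace_mulC; congr (\tr (_ *m _)).
by rewrite /comm !raddfB /= !trmx_mul !trmxK.
Qed.

Definition step_conj A : 'M[R]_d := 1%:M - 100^-1 *: moment A.

Lemma frob_moment A : frob A <= 1 -> frob (moment A) <= 2.
Proof.
move=> A1; apply: le_trans (frob_comm _ _) _; rewrite frob_trmx.
have := frob_ge0 A; nra.
Qed.

(** On the unit ball |moment A| <= 2, so [step_conj A] is within 1/50 of the identity and the factor
    2 is generous. Rows [X] give invertibility, square [X] give the bounds on [step_dir]. *)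
Lemma frob_mul_step_conj m A (X : 'M[R]_(m, d)) : frob A <= 1 ->
  frob X <= 2 * frob (X *m step_conj A).
Proof.
move=> A1; have : frob X <= frob (X *m step_conj A) + 100^-1 * (frob X * 2).
  rewrite {1}(_ : X = X *m step_conj A + 100^-1 *: (X *m moment A)).
    rewrite (le_trans (frobD _ _)) // frobZ ger0_norm // lerD2l.
    rewrite ler_wpM2l // (le_trans (frobM _ _)) // ler_wpM2l ?frob_ge0 //.
    exact: frob_moment.
  by rewrite /step_conj mulmxBr mulmx1 -scalemxAr subrK.
have := frob_ge0 X; lra.
Qed.

Lemma step_conj_unit A : frob A <= 1 -> step_conj A \in unitmx.
Proof.
move=> A1; rewrite -row_free_unit; apply: inj_row_free => v vS0.
apply: frob_eq0; apply/eqP; rewrite eq_le frob_ge0 andbT.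
by have := frob_mul_step_conj v A1; rewrite vS0 frob0 mulr0.
Qed.

(** With g = [step_conj A] one has g A - A g = - [grad A] / 100, hence g A g^-1 = A - [grad A] g^-1
    / 100; this is the form of [step]. *)
Definition step_dir A := grad A *m invmx (step_conj A).
Definition step A := A - 100^-1 *: step_dir A.

Lemma step_dirK A : frob A <= 1 -> step_dir A *m step_conj A = grad A.
Proof. by move=> A1; rewrite mulmxKV // step_conj_unit. Qed.

Lemma step_dirE A : frob A <= 1 ->
  step_dir A = grad A + 100^-1 *: (step_dir A *m moment A).
Proof.
by move=> /step_dirK <-; rewrite /step_conj mulmxBr mulmx1 -scalemxAr subrK.
Qed.

Lemma step_similar A : frob A <= 1 -> step A *m step_conj A = step_conj A *m A.
Proof.
move=> A1; rewrite /step mulmxBl -scalemxAl step_dirK // /step_conj /grad.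
move: (moment A) => M; rewrite /comm mulmxBr mulmxBl mulmx1 mul1mx scalerBr.
by rewrite -scalemxAr -scalemxAl opprB addrA subrK.
Qed.

Lemma det_scalar_sub_step A (x : R) : frob A <= 1 ->
  \det (x%:M - step A) = \det (x%:M - A).
Proof.
move=> A1; have gU : \det (step_conj A) != 0.
  by rewrite -unitfE -unitmxE step_conj_unit.
have : (x%:M - step A) *m step_conj A = step_conj A *m (x%:M - A).
  rewrite mulmxBl step_similar //; move: (step_conj A) => g.
  by rewrite mulmxBr scalar_mxC.
move=> /(congr1 determinant); rewrite !det_mulmx [RHS]mulrC.
exact: mulIf.
Qed.

Lemma frob_grad A : frob A <= 1 -> frob (grad A) <= 2 * frob (moment A).
Proof.
move=> A1; apply: le_trans (frob_comm _ _) _.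
have := frob_ge0 (moment A); nra.
Qed.

Lemma frob_step_dir A : frob A <= 1 -> frob (step_dir A) <= 2 * frob (grad A).
Proof. by move=> A1; rewrite -(step_dirK A1) frob_mul_step_conj. Qed.

(** The leading change of |A|^2 is -2 |M|^2 / 100 by [frob_dot_grad]; the corrections are multiples
    of |M|^2 / 100^2 and take back less than half. In particular the unit ball is preserved. *)
Lemma frob_step A : frob A <= 1 ->
  frob (step A) ^+ 2 <= frob A ^+ 2 - 100^-1 * frob (moment A) ^+ 2.
Proof.
move=> A1; rewrite /step -scaleNr frob_sqr_add frobZ normrN ger0_norm //.
rewrite frob_dotZr (frob_dotC A).
have eX := congr1 (fun X => frob_dot X A) (step_dirE A1).
rewrite frob_dotDl frob_dotZl frob_dot_grad in eX; rewrite eX exprMn.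
have h1 := frob_step_dir A1; have h2 := frob_grad A1.
have h3 := frob_CS (step_dir A *m moment A) A.
have h4 := frobM (step_dir A) (moment A).
move: h3; rewrite ler_norml => /andP[h3 _].
have := frob_ge0 A; have := frob_ge0 (moment A); have := frob_ge0 (step_dir A).
have := frob_ge0 (step_dir A *m moment A).
set a := frob A in A1 h3 *; set mu := frob (moment A) in h1 h2 h3 h4 *.
set x := frob (step_dir A) in h1 h2 h3 h4 *.
set y := frob (_ *m _) in h3 h4 *; set z := frob_dot _ _ in h3 *.
move=> y0 x0 mu0 a0.
have hx : x <= 4 * mu by lra.
have hy : y <= 4 * mu ^+ 2 by nra.
have hz : - (4 * mu ^+ 2) <= z by nra.
have hx2 : x ^+ 2 <= 16 * mu ^+ 2 by nra.
have := sqr_ge0 mu; lra.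
Qed.

(** The linear change of |M|^2 is 4 <D, N> with D close to - N / 100, that is about - |N|^2 / 25;
    the remaining terms leave at least |N|^2 / 100 of this drop. *)
Lemma frob_moment_step A : frob A <= 1 ->
  frob (moment (step A)) ^+ 2 <=
  frob (moment A) ^+ 2 - 100^-1 * frob (grad A) ^+ 2.
Proof.
move=> A1; rewrite /step -scaleNr momentD frob_sqr_add.
set D := _ *: _; set E := comm D A^T + _ + _.
have h1 := frob_step_dir A1.
have hM := frob_moment A1.
have hN := frob_grad A1.
have hD : frob D <= 2 * 100^-1 * frob (grad A).
  by rewrite frobZ normrN ger0_norm //; lra.
have hE : frob E <= 6 * frob D.
  have e1 := frob_comm D A^T; have e2 := frob_comm A D^T.
  have e3 := frob_comm D D^T; rewrite !frob_trmx in e1 e2 e3.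
  have e4 := frobD (comm D A^T + comm A D^T) (comm D D^T).
  have e5 := frobD (comm D A^T) (comm A D^T).
  have := frob_ge0 D; rewrite -/E in e4; nra.
have hME : frob_dot (moment A) E <=
    2 * frob_dot D (grad A) + 4 * frob D ^+ 2.
  rewrite /E 2!frob_dotDr frob_dot_moment_l frob_dot_moment_r.
  have e3 := frob_comm D D^T; rewrite !frob_trmx in e3.
  have := frob_dot_le (moment A) (comm D D^T).
  have := frob_ge0 D; have := frob_ge0 (comm D D^T).
  have := frob_ge0 (moment A); nra.
have hDN : frob_dot D (grad A) <= - 100^-1 * frob (grad A) ^+ 2 * (1 - 4 / 100).
  rewrite frob_dotZl step_dirE // frob_dotDl frob_dotZl -frob_sqr.
  have := frob_CS (step_dir A *m moment A) (grad A).
  have := frobM (step_dir A) (moment A); rewrite ler_norml.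
  have := frob_ge0 (step_dir A *m moment A); have := frob_ge0 (step_dir A).
  move: h1 hM hN; set x := frob (step_dir A); set y := frob (_ *m _).
  set z := frob_dot _ _; have := frob_ge0 (grad A); set n := frob (grad A).
  have := frob_ge0 (moment A); set mu := frob (moment A).
  move=> mu0 n0 h1 hM hN x0 y0 h4 /andP[h3 _].
  have hy : y <= 4 * n by nra.
  have hz : - (4 * n ^+ 2) <= z by nra.
  lra.
have := frob_ge0 D; have := frob_ge0 E; have := frob_ge0 (grad A).
move=> n0 E0 D0.
have hD2 : frob D ^+ 2 <= 4 / 10000 * frob (grad A) ^+ 2 by nra.
have hE2 : frob E ^+ 2 <= 36 * frob D ^+ 2 by nra.
have := sqr_ge0 (frob (grad A)); lra.
Qed.

Lemma frob_comm_dist A B A' B' :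
  frob (comm A B - comm A' B') <=
  2 * (frob (A - A') * frob B + frob A' * frob (B - B')).
Proof.
rewrite (_ : _ - _ = comm (A - A') B + comm A' (B - B')); last first.
  by rewrite /comm !(mulmxBl, mulmxBr); apply/matrixP=> i j; rewrite !mxE; ring.
apply: le_trans (frobD _ _) _.
have := frob_comm (A - A') B; have := frob_comm A' (B - B'); lra.
Qed.

(** This makes every fixed iterate Lipschitz. The resulting constant 2^n may grow, because the limit
    is approximated uniformly by a single iterate. *)
Lemma frob_step_lipschitz A B : frob A <= 1 -> frob B <= 1 ->
  frob (step A - step B) <= 2 * frob (A - B).
Proof.
move=> A1 B1; set e := frob (A - B).
have e0 : 0 <= e := frob_ge0 _.
have hM : frob (moment A - moment B) <= 4 * e.
  have := frob_comm_dist A A^T B B^T.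
  by rewrite -raddfB /= !frob_trmx -/e; nra.
have hN : frob (grad A - grad B) <= 12 * e.
  have := frob_comm_dist (moment A) A (moment B) B; rewrite -/e.
  have := frob_moment B1; have := frob_ge0 (moment A - moment B).
  have := frob_ge0 A; nra.
have hX : frob (step_dir A - step_dir B) <= 25 * e.
  have := frob_mul_step_conj (step_dir A - step_dir B) A1.
  rewrite mulmxBl step_dirK // (_ : step_dir B *m step_conj A =
     grad B - 100^-1 *: (step_dir B *m (moment A - moment B))); last first.
    rewrite -[grad B](step_dirK B1) /step_conj.
    move: (moment A) (moment B) (step_dir B) => M M' X.
    by rewrite !mulmxBr mulmx1 scalerBr -!scalemxAr opprB addrA subrK.
  rewrite opprB addrCA addrC.
  have := frobD (grad A - grad B)
    (100^-1 *: (step_dir B *m (moment A - moment B))).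
  rewrite frobZ ger0_norm //.
  have := frobM (step_dir B) (moment A - moment B).
  have hB : frob (step_dir B) <= 8.
    have := frob_step_dir B1; have := frob_grad B1; have := frob_moment B1; lra.
  have := frob_ge0 (step_dir B); have := frob_ge0 (moment A - moment B).
  set x := frob (step_dir B) in hB *; set m := frob (moment A - _) in hM *.
  move=> m0 x0 hxm; have : x * m <= 32 * e by nra.
  lra.
rewrite (_ : _ - _ = (A - B) - 100^-1 *: (step_dir A - step_dir B)).
  apply: le_trans (frobB _ _) _; rewrite frobZ ger0_norm // -/e; lra.
rewrite /step; move: (step_dir A) (step_dir B) => X Y.
by apply/matrixP=> i j; rewrite !mxE; ring.
Qed.
End Flow.

(** * The Lojasiewicz inequality *)

Section Cut.
Variables (R : realType) (d : nat) (w : 'I_d -> 'I_d -> R).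
Hypothesis w_ge0 : forall i j, 0 <= w i j.
Let l i := \sum_j (w i j - w j i).

Lemma sum_net_flow_eq0 : \sum_i l i = 0.
Proof.
rewrite /l; under eq_bigr do rewrite sumrB.
by rewrite sumrB [X in _ - X]exchange_big subrr.
Qed.

(** Edges inside [S] cancel, so the net outflow of [S] is what leaves [S] minus what enters it. *)
Lemma sum_net_flow_le (S : pred 'I_d) :
  \sum_(i | S i) l i <= \sum_(i | S i) \sum_(j | ~~ S j) w i j.
Proof.
have -> : \sum_(i | S i) l i =
    \sum_(i | S i) \sum_(j | ~~ S j) (w i j - w j i).
  rewrite /l; under eq_bigr do rewrite (bigID S) /=.
  rewrite big_split /= [X in X + _](_ : _ = 0) ?add0r //.
  under eq_bigr do rewrite sumrB.
  by rewrite sumrB [X in _ - X]exchange_big subrr.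
by apply: ler_sum => i _; apply: ler_sum => j _; rewrite gerBl.
Qed.

(** Pigeonhole: divide ]l b, l a] into d equal half-open intervals. Among the d values [l b] lies in
    none of them, so some interval is empty; [t] is its left end. *)
Lemma net_flow_gap (a b : 'I_d) : l b < l a ->
  exists t, [/\ l b <= t, t < l a &
    forall i, l i <= t \/ t + (l a - l b) / d%:R < l i].
Proof.
move=> ab; have d0 : (0 < d%:R :> R).
  by rewrite ltr0n (leq_ltn_trans _ (ltn_ord a)).
pose th (r : nat) := l b + (l a - l b) * r%:R / d%:R.
have thS r : th r.+1 = th r + (l a - l b) / d%:R.
  by rewrite /th -natr1 mulrDr mulr1 mulrDl addrA.
have th_le r s : (r <= s)%N -> th r <= th s.
  move=> rs; rewrite /th lerD2l ler_wpM2r ?invr_ge0 ?ler0n //.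
  by rewrite ler_wpM2l ?ler_nat // subr_ge0 ltW.
have [[r hr]|no] := pselect (exists r : 'I_d,
    forall i, l i <= th r \/ th r.+1 < l i).
  exists (th r); split.
  - by rewrite lerDl divr_ge0 // mulr_ge0 // subr_ge0 ltW.
  - rewrite -ltrBrDl -mulrA -[ltRHS]mulr1 ltr_pM2l ?subr_gt0 //.
    by rewrite ltr_pdivrMr // mul1r ltr_nat.
  - by move=> i; rewrite -thS.
(* Otherwise every interval contains some [l (h r)]; [h] is then injective, hence onto, and [b]
   itself would be attained. *)
have /choice[h hP] : forall r : 'I_d, exists i, th r < l i /\ l i <= th r.+1.
  move=> r; apply: contrapT => H; apply: no; exists r => i.
  case: (lerP (l i) (th r)) => [|h1]; first by left.
  by right; rewrite ltNge; apply/negP => h2; apply: H; exists i.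
have h_inj : injective h.
  have aux (r s : 'I_d) : h r = h s -> ~ (r < s)%N.
    move=> rs /th_le; have [_] := hP r; have [+ _] := hP s; rewrite rs.
    by move=> h1 h2 h3; have := lt_le_trans h1 (le_trans h2 h3); rewrite ltxx.
  move=> r s rs; apply/val_inj; case: (ltngtP r s) => // H.
    by case: (aux _ _ rs H).
  by case: (aux _ _ (esym rs) H).
have [g _ gK] := injF_bij h_inj.
have [+ _] := hP (g b); rewrite gK ltNge => /negP[].
by rewrite lerDl divr_ge0 // mulr_ge0 // subr_ge0 ltW.
Qed.

(** Cut at the gap: the vertices above it emit at least D / d, and each edge crossing downwards
    joins values at least D / d apart, so the right-hand sum is at least (D / d)^3. *)
Lemma net_flow_cut (a b : 'I_d) : (forall i, l b <= l i <= l a) -> l b < l a ->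
  (l a - l b) ^+ 3 <=
  d%:R ^+ 3 * \sum_i \sum_j (l i - l j) ^+ 2 * w i j.
Proof.
move=> hab ab; set D := l a - l b.
have d0 : (0 < d%:R :> R) by rewrite ltr0n (leq_ltn_trans _ (ltn_ord a)).
have D0 : 0 < D by rewrite subr_gt0.
have ha : D / d%:R <= l a.
  have : \sum_(i < d) (l a - l i) = l a * d%:R.
    by rewrite sumrB sum_net_flow_eq0 subr0 sumr_const card_ord mulr_natr.
  rewrite ler_pdivrMr // => <-; rewrite (bigD1 b) //= lerDl.
  by apply: sumr_ge0 => i _; rewrite subr_ge0; have /andP[] := hab i.
have hb : D / d%:R <= - l b.
  have : \sum_(i < d) (l i - l b) = - l b * d%:R.
    rewrite sumrB sum_net_flow_eq0 sub0r sumr_const card_ord.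
    by rewrite mulr_natr mulNrn.
  rewrite ler_pdivrMr // => <-; rewrite (bigD1 a) //= lerDl.
  by apply: sumr_ge0 => i _; rewrite subr_ge0; have /andP[] := hab i.
have [t [bt ta tP]] := net_flow_gap ab.
(* If t >= 0 every term is positive and the one at [a] suffices; if t < 0 the complementary sum is
   at most [l b], and the total is zero. *)
have hS : D / d%:R <= \sum_(i | t < l i) l i.
  have [t0|t0] := lerP 0 t.
    rewrite (le_trans ha) // (bigD1 a) //= lerDl.
    by apply: sumr_ge0 => i /andP[ti _]; rewrite ltW // (le_lt_trans t0).
  have /eqP := sum_net_flow_eq0; rewrite (bigID (fun i => t < l i)) /=.
  rewrite addr_eq0 => /eqP ->; rewrite (le_trans hb) // lerN2.
  rewrite (bigD1 b) /=; last by rewrite -leNgt.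
  rewrite gerDl; apply: sumr_le0 => i /andP[ti _].
  by rewrite ltW // (le_lt_trans _ t0) // leNgt.
have hw : (D / d%:R) ^+ 2 * \sum_(i | t < l i) \sum_(j | ~~ (t < l j)) w i j <=
    \sum_i \sum_j (l i - l j) ^+ 2 * w i j.
  have pos i j : 0 <= (l i - l j) ^+ 2 * w i j by rewrite mulr_ge0 // sqr_ge0.
  rewrite [leRHS](bigID (fun i => t < l i)) /= -[leLHS]addr0.
  rewrite lerD //; last first.
    by apply: sumr_ge0 => i _; apply: sumr_ge0.
  rewrite big_distrr; apply: ler_sum => i ti /=.
  rewrite [leRHS](bigID (fun i => t < l i)) /= -[leLHS]add0r lerD //.
    exact: sumr_ge0.
  rewrite big_distrr; apply: ler_sum => j; rewrite -leNgt => tj /=.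
  rewrite ler_wpM2r // ler_pXn2r ?nnegrE ?divr_ge0 ?(ltW D0) //.
    by case: (tP i) => [|h]; [rewrite leNgt ti | rewrite -/D in h; lra].
  by rewrite subr_ge0 ltW // (le_lt_trans tj).
have : (D / d%:R) ^+ 3 <= \sum_i \sum_j (l i - l j) ^+ 2 * w i j.
  apply: le_trans hw; rewrite exprSr ler_wpM2l ?sqr_ge0 //.
  exact: le_trans hS (sum_net_flow_le _).
by rewrite expr_div_n ler_pdivrMr ?exprn_gt0 // mulrC.
Qed.

(** As the [l i] sum to zero, 0 lies between their extremes, so each |l i| is at most the spread D
    and m <= d D. This costs a second factor d^3 besides that of [net_flow_cut]. *)
Lemma net_flow_cubic (m : R) : 0 <= m -> m ^+ 2 = \sum_i l i ^+ 2 ->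
  m ^+ 3 <= d%:R ^+ 6 * \sum_i \sum_j (l i - l j) ^+ 2 * w i j.
Proof.
move=> m0 mE.
have Q0 : 0 <= \sum_i \sum_j (l i - l j) ^+ 2 * w i j.
  by do 2!(apply: sumr_ge0 => ? _); rewrite mulr_ge0 // sqr_ge0.
have [i0|no] := pselect (exists i : 'I_d, l i != 0); last first.
  have : m ^+ 2 = 0.
    rewrite mE big1 // => i _; apply/eqP; rewrite sqrf_eq0; apply/eqP.
    by apply: contrapT => H; apply: no; exists i; apply/eqP.
  move=> /eqP; rewrite sqrf_eq0 => /eqP ->.
  by rewrite expr0n mulr_ge0 // exprn_ge0.
case: i0 => i0 li0.
pose a := [arg max_(i > i0) l i]%O; pose b := [arg min_(i < i0) l i]%O.
have la i : l i <= l a by rewrite /a; case: arg_maxP => // j _ /(_ i); exact.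
have lb i : l b <= l i by rewrite /b; case: arg_minP => // j _ /(_ i); exact.
have a0 : 0 <= l a.
  rewrite leNgt; apply/negP => a0; have := sum_net_flow_eq0.
  rewrite (bigD1 i0) //= => H; have : \sum_(i | i != i0) l i <= 0.
    by apply: sumr_le0 => i _; rewrite (le_trans (la i)) // ltW.
  by have := la i0; lra.
have b0 : l b <= 0.
  rewrite leNgt; apply/negP => b0; have := sum_net_flow_eq0.
  rewrite (bigD1 i0) //= => H; have : 0 <= \sum_(i | i != i0) l i.
    by apply: sumr_ge0 => i _; rewrite (le_trans _ (lb i)) // ltW.
  by have := lb i0; lra.
have ab : l b < l a.
  rewrite lt_neqAle lb andbT; apply: contraNneq li0 => e.
  by apply/eqP; have := la i0; have := lb i0; lra.
have cut := net_flow_cut (a := a) (b := b).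
have {}cut := cut (fun i => introT andP (conj (lb i) (la i))) ab.
have d1 : 1 <= d%:R :> R by rewrite ler1n (leq_ltn_trans _ (ltn_ord i0)).
set D := l a - l b in cut.
have D0 : 0 <= D by rewrite subr_ge0 ltW.
have mD : m <= d%:R * D.
  rewrite -(@ler_pXn2r _ 2) ?nnegrE ?mulr_ge0 // mE.
  apply: (@le_trans _ _ (d%:R * D ^+ 2)); last first.
    by rewrite exprMn ler_wpM2r ?sqr_ge0 // expr2 ler_peMl.
  rewrite mulr_natl -[d in _ *+ d]card_ord -sumr_const; apply: ler_sum => i _.
  by have := la i; have := lb i; rewrite /D; nra.
apply: (@le_trans _ _ ((d%:R * D) ^+ 3)).
  by rewrite ler_pXn2r ?nnegrE // (le_trans m0).
rewrite exprMn (exprD _ 3 3) -mulrA ler_wpM2l // exprn_ge0 //; lra.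
Qed.
End Cut.

(** * Spectral weights: from matrices to net flows *)

Section SpectralWeights.
Variables (R : realType) (d : nat).
Local Notation C := R[i].
Local Notation rc := (real_complex R).
Implicit Types A : 'M[R]_d.
Local Open Scope sesquilinear_scope.

Lemma conjC_real_complex (x : R) : (rc x)^* = rc x.
Proof. by apply/CrealP/complex_realP; exists x. Qed.

Lemma sum_sqr_normC (X : 'M[C]_d) :
  \sum_i \sum_j `|X i j| ^+ 2 = \tr (X *m X ^t* ).
Proof.
apply: eq_bigr => i _; rewrite mxE; apply: eq_bigr => j _.
by rewrite !mxE normCK.
Qed.

Lemma trmxC_map_real A : (map_mx rc A) ^t* = map_mx rc A^T.
Proof. by apply/matrixP => i j; rewrite !mxE conjC_real_complex. Qed.

Lemma sum_sqr_unitary_conj (P : 'M[C]_d) A : P \is unitarymx ->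
  \sum_i \sum_j `|(P *m map_mx rc A *m P ^t* ) i j| ^+ 2 = rc (frob A ^+ 2).
Proof.
move=> PU; rewrite sum_sqr_normC !trmx_mul !map_mxM trmxCK trmxC_map_real.
rewrite !mulmxA mulmxKtV // mxtrace_mulC !mulmxA.
have -> : P ^t* *m P = 1%:M.
  by rewrite -invmx_unitary // mulVmx // unitarymx_unit.
by rewrite mul1mx -map_mxM trace_map_mx frob_sqr frob_dotE.
Qed.

(** In a unitary eigenbasis of the symmetric matrix [A, A^T], let [A] become B and [A, A^T] the
    diagonal D. The diagonal of D = B B^H - B^H B is the net outflow for the weights |B i j|^2, and
    [D, B] has entries (D i - D j) B i j. *)
Lemma spectral_weights A : exists w : 'I_d -> 'I_d -> R,
  let l i := \sum_j (w i j - w j i) in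
  [/\ forall i j, 0 <= w i j,
      frob (moment A) ^+ 2 = \sum_i l i ^+ 2 &
      frob (grad A) ^+ 2 = \sum_i \sum_j (l i - l j) ^+ 2 * w i j].
Proof.
set Mc := map_mx rc (moment A).
have MH : Mc \is normalmx.
  by apply/normalmxP; rewrite trmxC_map_real trmx_moment.
have MP := orthomx_spectralP MH.
have PU := spectral_unitarymx Mc.
move: MP PU; set P := spectralmx Mc; set D := spectral_diag Mc => MP PU.
rewrite invmx_unitary // in MP.
have PP : P *m P ^t* = 1%:M by exact/unitarymxP.
have P'P : P ^t* *m P = 1%:M.
  by rewrite -invmx_unitary // mulVmx // unitarymx_unit.
pose B := P *m map_mx rc A *m P ^t*.
have conjM (X Y : 'M[R]_d) : P *m map_mx rc (X *m Y) *m P ^t* =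
    (P *m map_mx rc X *m P ^t* ) *m (P *m map_mx rc Y *m P ^t* ).
  rewrite map_mxM -!mulmxA; congr (_ *m (_ *m _)).
  by rewrite !mulmxA P'P mul1mx.
have conjcomm (X Y : 'M[R]_d) : P *m map_mx rc (comm X Y) *m P ^t* =
    (P *m map_mx rc X *m P ^t* ) *m (P *m map_mx rc Y *m P ^t* ) -
    (P *m map_mx rc Y *m P ^t* ) *m (P *m map_mx rc X *m P ^t* ).
  by rewrite /comm map_mxB mulmxBr mulmxBl !conjM.
have BT : P *m map_mx rc A^T *m P ^t* = B ^t*.
  by rewrite /B !trmx_mul !map_mxM trmxCK trmxC_map_real mulmxA.
have MD : P *m Mc *m P ^t* = diag_mx D.
  by rewrite MP !mulmxA PP mul1mx -mulmxA PP mulmx1.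
have DB : diag_mx D = B *m B ^t* - B ^t* *m B.
  by rewrite -MD conjcomm BT.
have NB : P *m map_mx rc (grad A) *m P ^t* = diag_mx D *m B - B *m diag_mx D.
  by rewrite conjcomm -/Mc MD.
clearbody B.
pose w i j := complex.Re (`|B i j| ^+ 2).
have wE i j : rc (w i j) = `|B i j| ^+ 2.
  by apply: RRe_real; rewrite ger0_real // exprn_ge0.
have w0 i j : 0 <= w i j by rewrite -ler0c wE exprn_ge0.
exists w => l.
have lE i : D 0 i = rc (l i).
  have /matrixP/(_ i i) := DB; rewrite !mxE eqxx mulr1n => ->.
  rewrite rmorph_sum -sumrB; apply: eq_bigr => j _.
  rewrite rmorphB /= !wE !mxE !normCK.
  by rewrite [in LHS](mulrC _ (B j i)).
split=> //; apply: (@complexI R).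
  rewrite -(sum_sqr_unitary_conj _ PU) MD rmorph_sum; apply: eq_bigr => i _.
  rewrite (bigD1 i) //= big1 => [|j ji]; last first.
    by rewrite mxE eq_sym (negbTE ji) mulr0n normr0 expr0n.
  by rewrite addr0 mxE eqxx mulr1n lE normCK conjC_real_complex rmorphXn.
rewrite -(sum_sqr_unitary_conj _ PU) NB rmorph_sum; apply: eq_bigr => i _.
rewrite rmorph_sum; apply: eq_bigr => j _.
rewrite mul_diag_mx mul_mx_diag !mxE !lE mulrC -mulrBr -rmorphB normrM exprMn.
rewrite mulrC rmorphM rmorphXn [in RHS]/= wE; congr (_ * _).
by rewrite normCK [X in _ * X]conjC_real_complex.
Qed.

(** With f = |[A, A^T]|^2 this bounds f^(3/4) by a constant times |grad f|. The exponent is below 1,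
    so trajectories have finite length, controlled by f^(1/4). *)
Lemma lojasiewicz A :
  frob (moment A) ^+ 3 <= d%:R ^+ 6 * frob (grad A) ^+ 2.
Proof.
have [w /= [w0 M2 ->]] := spectral_weights A.
exact: net_flow_cubic (frob_ge0 _) M2.
Qed.
End SpectralWeights.

(** * The limit retraction *)

Section FrobeniusTopology.
Variable R : realType.
Local Open Scope classical_set_scope.

Lemma norm_le_frob m n (A : 'M[R]_(m, n)) : `|A| <= frob A.
Proof.
rewrite /Num.Def.normr /= mx_normrE; apply: bigmax_le => [|i _].
  exact: frob_ge0.
exact: frob_entry.
Qed.

Lemma entry_le_norm m n (A : 'M[R]_(m, n)) i j : `|A i j| <= `|A|.
Proof.
rewrite [leRHS]/Num.Def.normr /= mx_normrE.
exact: (le_bigmax _ (fun ij : 'I_m * 'I_n => `|A ij.1 ij.2|) (i, j)).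
Qed.

Lemma frob_le_norm m n (A : 'M[R]_(m, n)) : frob A <= (m * n)%:R * `|A|.
Proof.
apply: le_trans (frob_le_sum A) _; rewrite natrM -mulrA [leRHS]mulr_natl.
rewrite -[m in _ *+ m]card_ord -sumr_const; apply: ler_sum => i _.
rewrite mulr_natl -[n in _ *+ n]card_ord -sumr_const; apply: ler_sum => j _.
exact: entry_le_norm.
Qed.

(** The topology on matrices comes from the largest absolute entry, which is comparable with [frob]
    up to the factor m n. *)
Lemma cvg_frobP m n T (F : set_system T) (f : T -> 'M[R]_(m, n))
  (L : 'M[R]_(m, n)) :
  Filter F ->
  f x @[x --> F] --> L <->
  (forall e : R, 0 < e -> \forall x \near F, frob (L - f x) <= e).
Proof.
move=> FF; split=> [cf e e0|H].
  have e0' : 0 < e / (m * n).+1%:R by rewrite divr_gt0.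
  move/cvgrPdist_le: cf => /(_ _ e0'); apply: filterS => x hx.
  apply: le_trans (frob_le_norm _) _.
  apply: le_trans (ler_wpM2l _ hx) _ => //.
  rewrite mulrCA ler_piMr ?(ltW e0) // ler_pdivrMr // mul1r ler_nat.
  exact: leqnSn.
apply/cvgrPdist_le => e /H; apply: filterS => x.
exact: le_trans (norm_le_frob _).
Qed.

Lemma continuous_det d : continuous (fun A : 'M[R]_d => \det A).
Proof.
rewrite /determinant; apply: (@continuous_big R) => [|s _].
  exact: add_continuous.
have h : continuous (fun A : 'M[R]_d => \prod_i A i (perm.fun_of_perm s i)).
  apply: (@continuous_big R); first exact: mul_continuous.
  by move=> i _ M; exact: coord_continuous.
by move=> A; exact: (cvgM (cvg_cst _) (h A)).
Qed.

(** The intervals [u n - e n, u n + e n] meet pairwise, so the supremum of their left ends lies in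
    all of them; the error bound thus passes to the limit unchanged. *)
Lemma telescoping_limit (u e : nat -> R) :
  (forall n p, `|u (n + p)%N - u n| <= e n) ->
  exists l, forall n, `|l - u n| <= e n.
Proof.
move=> ue; pose S := range (fun n => u n - e n).
have ub m : ubound S (u m + e m).
  move=> _ [n _ <-]; case: (leqP m n) => [mn|/ltnW mn].
    have := ue m (n - m)%N; have := ue n 0%N.
    rewrite subnKC // addn0 subrr normr0 ler_norml => ? /andP[? ?]; lra.
  have := ue n (m - n)%N; have := ue m 0%N.
  rewrite subnKC // addn0 subrr normr0 ler_norml => ? /andP[? ?]; lra.
have S0 : S !=set0 by exists (u 0%N - e 0%N), 0%N.
have Ssup : has_sup S by split => //; exists (u 0%N + e 0%N).
exists (sup S) => n; rewrite ler_norml; apply/andP; split.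
  by rewrite lerBrDl; apply: sup_upper_bound => //; exists n.
by rewrite lerBlDl; apply: ge_sup.
Qed.
End FrobeniusTopology.

Section CharPoly.
Variables (R : realType) (d : nat).

Lemma horner_char_poly (A : 'M[R]_d) x : (char_poly A).[x] = \det (x%:M - A).
Proof.
rewrite -horner_evalE -det_map_mx; congr (\det _); apply/matrixP => i j.
rewrite !mxE /= horner_evalE !hornerE.
by case: eqP; rewrite ?mulr1n ?mulr0n !hornerE.
Qed.

(** The two polynomials agree at 1, 2, 3, ... Staying away from 0 lets [nilpotent_deflate] cancel a
    factor [x]. *)
Lemma char_poly_eqXn (A : 'M[R]_d) :
  (forall x, x != 0 -> \det (x%:M - A) = x ^+ d) -> char_poly A = 'X^d.
Proof.
move=> H; apply/eqP; rewrite -subr_eq0; apply/eqP.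
set p := _ - _.
apply: (@roots_geq_poly_eq0 _ _ [seq n.+1%:R | n <- iota 0 (size p)]).
- apply/allP => _ /mapP[n _ ->].
  rewrite /root /p hornerD hornerN horner_char_poly H ?pnatr_eq0 //.
  by rewrite hornerXn subrr.
- by rewrite map_inj_uniq ?iota_uniq // => m n /eqP; rewrite eqr_nat => /eqP[].
- by rewrite size_map size_iota.
Qed.
End CharPoly.

(** * Uniform convergence of the iteration and its limit map *)

Section Retraction.
Variables (R : realType) (d : nat).
Local Open Scope classical_set_scope.
Implicit Types A B : 'M[R]_d.
Local Notation flow n := (iter n (@step R d)).

Lemma frob_iter_step_sqr n A : frob A <= 1 ->
  frob (flow n A) ^+ 2 <=
    frob A ^+ 2 - 100^-1 * \sum_(k < n) frob (moment (flow k A)) ^+ 2 /\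
  frob (flow n A) <= 1.
Proof.
move=> A1; elim: n => [|n [IH1 IH2]]; first by rewrite big_ord0 mulr0 subr0.
have h := frob_step IH2; rewrite big_ord_recr /= mulrDr.
split; first by lra.
rewrite -(@ler_pXn2r _ 2) ?nnegrE ?frob_ge0 // (le_trans h) //.
have := sqr_ge0 (frob (moment (flow n A))).
have : frob (flow n A) ^+ 2 <= 1 ^+ 2.
  by rewrite ler_pXn2r ?nnegrE ?frob_ge0.
lra.
Qed.

Lemma frob_iter_step n A : frob A <= 1 -> frob (flow n A) <= 1.
Proof. by move=> /(frob_iter_step_sqr n)[]. Qed.

Lemma frob_moment_step_le A : frob A <= 1 ->
  frob (moment (step A)) <= frob (moment A).
Proof.
move=> A1; rewrite -(@ler_pXn2r _ 2) ?nnegrE ?frob_ge0 //.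
by rewrite (le_trans (frob_moment_step A1)) // gerBl mulr_ge0 // sqr_ge0.
Qed.

Lemma frob_moment_iter_step_le n m A : frob A <= 1 -> (n <= m)%N ->
  frob (moment (flow m A)) <= frob (moment (flow n A)).
Proof.
move=> A1 /subnK <-; elim: (m - n)%N => [|p IH]; first by rewrite add0n.
by rewrite addSn (le_trans (frob_moment_step_le _)) //= frob_iter_step.
Qed.

(** The values |M|^2 along the iteration decrease and, by [frob_iter_step_sqr], sum to at most
    100. *)
Lemma frob_moment_iter_step n A : frob A <= 1 ->
  n%:R * frob (moment (flow n A)) ^+ 2 <= 100.
Proof.
move=> A1; have [h _] := frob_iter_step_sqr n A1.
have a1 : frob A ^+ 2 <= 1 ^+ 2 by rewrite ler_pXn2r ?nnegrE ?frob_ge0.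
have : n%:R * frob (moment (flow n A)) ^+ 2 <=
    \sum_(k < n) frob (moment (flow k A)) ^+ 2.
  rewrite mulr_natl -[X in _ *+ X]card_ord -sumr_const; apply: ler_sum => k _.
  rewrite ler_pXn2r ?nnegrE ?frob_ge0 //.
  by apply: frob_moment_iter_step_le => //; exact/ltnW.
have := sqr_ge0 (frob (flow n A)); lra.
Qed.

(* Concavity of the fourth root turns the cubic Lojasiewicz inequality into a
   telescoping bound on the displacement. *)
Lemma frob_step_sub A : frob A <= 1 ->
  frob (step A - A) <= 8 * d%:R ^+ 3 *
    (Num.sqrt (frob (moment A)) - Num.sqrt (frob (moment (step A)))).
Proof.
move=> A1; have -> : step A - A = - (100^-1 *: step_dir A).
  by rewrite /step addrC addKr.
rewrite frobN frobZ ger0_norm //.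
have h1 := frob_step_dir A1; have h2 := frob_moment_step A1.
have h3 := lojasiewicz A; have h4 := frob_moment_step_le A1.
set s := Num.sqrt (frob (moment A)); set t := Num.sqrt _.
have sE : frob (moment A) = s ^+ 2 by rewrite sqr_sqrtr ?frob_ge0.
have tE : frob (moment (step A)) = t ^+ 2 by rewrite sqr_sqrtr ?frob_ge0.
have s0 : 0 <= s by exact: sqrtr_ge0.
have t0 : 0 <= t by exact: sqrtr_ge0.
have ts : t <= s by rewrite ler_sqrt ?frob_ge0.
have n0 := frob_ge0 (grad A); set n := frob (grad A) in h1 h2 h3 n0 *.
rewrite sE tE in h2 h3; set K : R := d%:R ^+ 3.
have K0 : 0 <= K by rewrite exprn_ge0.
have h5 : s ^+ 3 <= K * n.
  rewrite -(@ler_pXn2r _ 2) ?nnegrE ?mulr_ge0 ?exprn_ge0 //.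
  by rewrite -exprM (exprM s 2 3) (le_trans h3) // exprMn -exprM.
(* This is s^4 - t^4 <= 4 s^3 (s - t), followed by the Lojasiewicz bound s^3 <= K n; dividing by n
   then gives a bound linear in s - t. *)
have h6 : 100^-1 * n ^+ 2 <= 4 * (K * n) * (s - t).
  apply: (@le_trans _ _ (4 * s ^+ 3 * (s - t))); last first.
    by rewrite ler_wpM2r ?subr_ge0 // ler_wpM2l.
  have : t ^+ 2 <= s ^+ 2 by rewrite ler_pXn2r ?nnegrE.
  have -> : 4 * s ^+ 3 * (s - t) = (s ^+ 2) ^+ 2 - (t ^+ 2) ^+ 2 +
     (s - t) ^+ 2 * (3 * s ^+ 2 + 2 * s * t + t ^+ 2) by ring.
  have : 0 <= (s - t) ^+ 2 * (3 * s ^+ 2 + 2 * s * t + t ^+ 2).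
    by rewrite mulr_ge0 ?sqr_ge0 // !addr_ge0 ?mulr_ge0 ?sqr_ge0.
  lra.
have h7 : n <= 400 * K * (s - t).
  have Kst : 0 <= K * (s - t) by rewrite mulr_ge0 // subr_ge0.
  have [->|nn] := eqVneq n 0; first by lra.
  have n1 : 0 < n by rewrite lt_def nn.
  rewrite -(ler_pM2r n1); have -> : n * n = 100 * (100^-1 * n ^+ 2).
    by rewrite mulrA mulfV // mul1r expr2.
  apply: le_trans (ler_wpM2l _ h6) _ => //.
  by rewrite le_eqVlt; apply/orP; left; apply/eqP; ring.
lra.
Qed.

Lemma frob_iter_step_sub n p A : frob A <= 1 ->
  frob (flow (n + p) A - flow n A) <=
  8 * d%:R ^+ 3 * Num.sqrt (frob (moment (flow n A))).
Proof.
move=> A1; set K := 8 * _.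
have K0 : 0 <= K by rewrite mulr_ge0 // exprn_ge0.
apply: (@le_trans _ _ (K * (Num.sqrt (frob (moment (flow n A))) -
   Num.sqrt (frob (moment (flow (n + p) A)))))); last first.
  by rewrite ler_wpM2l // gerBl sqrtr_ge0.
elim: p => [|p IH]; first by rewrite addn0 !subrr mulr0 frob0.
rewrite addnS /=; set B := iter (n + p) _ _ in IH *.
have := frob_step_sub (frob_iter_step (n + p) A1); rewrite -/B -/K.
have := frob_dist_triangle B (step B) (flow n A); lra.
Qed.

(** Two powers of [d] more than in [frob_iter_step_sub]: the limit is taken entry by entry, and
    [frob] is bounded by the sum of the d^2 entries. *)
Definition limit_error n A : R :=
  8 * d%:R ^+ 5 * Num.sqrt (frob (moment (flow n A))).

Lemma iter_step_limit A : frob A <= 1 ->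
  exists L, forall n, frob (L - flow n A) <= limit_error n A.
Proof.
move=> A1; pose e n : R := 8 * d%:R ^+ 3 * Num.sqrt (frob (moment (flow n A))).
have /choice[L LP] : forall ij : 'I_d * 'I_d, exists l, forall n,
    `|l - flow n A ij.1 ij.2| <= e n.
  move=> [i j] /=; apply: telescoping_limit => n p.
  apply: le_trans (frob_iter_step_sub n p A1).
  have := frob_entry (flow (n + p) A - flow n A) i j.
  by rewrite !mxE.
exists (\matrix_(i, j) L (i, j)) => n; apply: le_trans (frob_le_sum _) _.
have -> : limit_error n A = \sum_(i < d) \sum_(j < d) e n.
  rewrite !sumr_const !card_ord -mulrnA -(mulr_natr (e n)) natrM.
  by rewrite /limit_error /e (exprD _ 3 2) (expr2 d%:R); ring.
apply: ler_sum => i _; apply: ler_sum => j _.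
have := LP (i, j) n; move: (iter n _ A) => /= B.
by rewrite !mxE.
Qed.

Lemma limit_error_cvg (e : R) : 0 < e ->
  exists N, forall n A, (N <= n)%N -> frob A <= 1 -> limit_error n A <= e.
Proof.
move=> e0; pose K : R := 8 * d%:R ^+ 5 + 1.
have K0 : 0 < K by rewrite ltr_wpDl // mulr_ge0 // exprn_ge0.
(* Since n |M|^2 <= 100, taking n > 100 / c gives |M|^2 <= c, that is sqrt |M| <= e / K, with n
   independent of [A]. *)
pose c := (e / K) ^+ 4.
have c0 : 0 < c by rewrite exprn_gt0 // divr_gt0.
exists (Num.bound (100 / c)) => n A Nn A1.
have n1 : 100 / c < n%:R.
  apply: lt_le_trans (archi_boundP _) _; last by rewrite ler_nat.
  by rewrite divr_ge0 // ltW.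
have := frob_moment_iter_step n A1; rewrite /limit_error.
set mu := frob _ => H; have mu0 : 0 <= mu by exact: frob_ge0.
have hmu : mu ^+ 2 <= c.
  have n0 : 0 < n%:R :> R by rewrite (le_lt_trans _ n1) // divr_ge0 // ltW.
  rewrite -(ler_pM2l n0) (le_trans H) //.
  by rewrite ltW // -ltr_pdivrMr.
have eK : 0 <= e / K by rewrite divr_ge0 // ltW.
have hs : Num.sqrt mu <= e / K.
  rewrite -(@ler_pXn2r _ 4) ?nnegrE ?sqrtr_ge0 //.
  by rewrite (exprM _ 2 2) sqr_sqrtr.
apply: (@le_trans _ _ (K * (e / K))).
  by apply: ler_pM; rewrite ?mulr_ge0 ?exprn_ge0 ?sqrtr_ge0 // lerDl.
by rewrite mulrCA mulfV ?mulr1 // gt_eqF.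
Qed.

Lemma frob_iter_step_lipschitz n A B : frob A <= 1 -> frob B <= 1 ->
  frob (flow n A - flow n B) <= 2 ^+ n * frob (A - B).
Proof.
move=> A1 B1; elim: n => [|n IH]; first by rewrite expr0 mul1r.
rewrite exprS -mulrA; apply: le_trans (frob_step_lipschitz _ _) _.
- exact: frob_iter_step.
- exact: frob_iter_step.
- by rewrite ler_wpM2l.
Qed.

Lemma det_iter_step n A x : frob A <= 1 ->
  \det (x%:M - flow n A) = \det (x%:M - A).
Proof.
move=> A1; elim: n => //= n IH.
by rewrite det_scalar_sub_step // frob_iter_step.
Qed.

Lemma normal_retraction : exists r : 'M[R]_d -> 'M[R]_d,
  [/\ forall A, frob A <= 1 -> real_normal (r A),
      forall A, frob A <= 1 -> real_normal A -> r A = A,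
      forall e, 0 < e -> exists2 del, 0 < del & forall A B, frob A <= 1 ->
        frob B <= 1 -> frob (A - B) <= del -> frob (r A - r B) <= e &
      forall A, frob A <= 1 -> r A = 0 -> char_poly A = 'X^d].
Proof.
have /choice[r rP] : forall A, exists L, frob A <= 1 ->
    forall n, frob (L - flow n A) <= limit_error n A.
  (* The value 0 outside the unit ball is a default; all four properties concern the ball only. *)
  move=> A; have [A1|A1] := pselect (frob A <= 1); last by exists 0.
  by have [L LP] := iter_step_limit A1; exists L.
have r1 A : frob A <= 1 -> frob (r A) <= 1.
  move=> A1; apply/ler_addgt0Pr => e e0.
  have [N /(_ N A (leqnn _) A1) NP] := limit_error_cvg e0.
  have := frobD (flow N A) (r A - flow N A).
  rewrite subrKC; have := rP A A1 N; have := frob_iter_step N A1; lra.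
exists r; split.
- move=> A A1; suff : frob (moment (r A)) = 0.
    by move=> /frob_eq0 /eqP; rewrite /moment /comm subr_eq0 => /eqP.
  apply/eqP; rewrite eq_le frob_ge0 andbT; apply/ler_addgt0Pr => e e0.
  rewrite add0r.
  (* On the unit ball [moment] is 4-Lipschitz, so closeness e / 8 costs e / 2; the other half bounds
     [moment] of the iterate. *)
  have e8 : 0 < e / 8 by lra.
  have [N NP] := limit_error_cvg e8.
  pose n := (N + Num.bound (100 / (e / 2) ^+ 2))%N.
  have := NP n A (leq_addr _ _) A1; have := rP A A1 n.
  have := frob_moment_iter_step n A1; have h2 := frob_iter_step n A1.
  set B := iter n _ A in h2 *.
  have h1 := r1 A A1 => h3 h4 h5.
  have hM : frob (moment (r A) - moment B) <= 4 * frob (r A - B).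
    have := frob_comm_dist (r A) (r A)^T B B^T.
    rewrite -raddfB /= !frob_trmx; have := frob_ge0 (r A - B); nra.
  have hB : frob (moment B) <= e / 2.
    rewrite -(@ler_pXn2r _ 2) ?nnegrE ?frob_ge0 //; last by lra.
    have e2 : 0 < (e / 2) ^+ 2 by rewrite exprn_gt0 // divr_gt0.
    have c0 : 0 <= 100 / (e / 2) ^+ 2 by rewrite divr_ge0 // ltW.
    have n1 : 100 / (e / 2) ^+ 2 < n%:R.
      by apply: lt_le_trans (archi_boundP c0) _; rewrite ler_nat leq_addl.
    have n0 : 0 < n%:R :> R by exact: le_lt_trans n1.
    rewrite -(ler_pM2l n0) (le_trans h3) //.
    by rewrite ltW // -ltr_pdivrMr.
  have := frobD (moment (r A) - moment B) (moment B); rewrite subrK; lra.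
- move=> A A1 AN.
  (* At a normal matrix the error bound vanishes already for n = 0. *)
  have M0 : moment A = 0 by rewrite /moment /comm AN subrr.
  apply/eqP; rewrite -subr_eq0; apply/eqP/frob_eq0/eqP.
  rewrite eq_le frob_ge0 andbT; have := rP A A1 0%N.
  by rewrite /limit_error /= M0 frob0 sqrtr0 mulr0.
(* Three thirds: the limit errors of [A] and [B] after N steps, and the 2^N-Lipschitz iterate
   between them. *)
- move=> e e0; have e3 : 0 < e / 3 by lra.
  have [N NP] := limit_error_cvg e3.
  have t0 : 0 < 2 ^+ N :> R by rewrite exprn_gt0.
  exists (e / 3 / 2 ^+ N); first by rewrite divr_gt0.
  move=> A B A1 B1; rewrite ler_pdivlMr // mulrC => AB.
  have := frob_iter_step_lipschitz N A1 B1.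
  have := rP A A1 N; have := rP B B1 N.
  have := NP N A (leqnn _) A1; have := NP N B (leqnn _) B1.
  set a := iter N _ A; set b := iter N _ B => h1 h2 h3 h4 h5.
  have := frob_dist_triangle a (r A) (r B).
  have := frob_dist_triangle b a (r B).
  rewrite (frob_distC b); lra.
- move=> A A1 rA0; apply: char_poly_eqXn => x _.
  rewrite -det_scalar -[x%:M in RHS]subr0.
  (* This sequence is constant, equal to \det (x - A), while its limit is \det x = x^d. *)
  have : (fun n => \det (x%:M - flow n A)) @ \oo -->
      \det (x%:M - 0 : 'M[R]_d).
    apply: (@cvg_comp _ _ _ (fun n => x%:M - flow n A)
      (fun B : 'M[R]_d => \det B)); last exact: continuous_det.
    apply/cvg_frobP => e e0; have [N NP] := limit_error_cvg e0.
    exists N => // n /= Nn; rewrite subr0 opprB addrCA subrr addr0.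
    have := rP A A1 n; rewrite rA0 sub0r frobN => h.
    exact: le_trans h (NP _ _ Nn A1).
  under eq_fun do rewrite det_iter_step //.
  by move=> /cvg_lim <- //; rewrite lim_cst.
Qed.
End Retraction.

(** * Polynomial parametrisation of nilpotent matrices *)

Section PolynomialFunctions.
Variable R : realType.

(** The degree is bounded in each variable separately, so the coefficients form a box of (E +
    1)^#|V| monomials; this is the number that [polyfun_avoid] counts. *)
Definition polydeg (V : finType) E (f : (V -> R) -> R) :=
  exists c : {ffun V -> 'I_E.+1} -> R,
  forall x, f x = \sum_a c a * \prod_i x i ^+ a i.

Lemma eq_polydeg (V : finType) E (f g : (V -> R) -> R) :
  f =1 g -> polydeg E f -> polydeg E g.
Proof. by move=> fg [c cP]; exists c => x; rewrite -fg. Qed.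

Lemma polydeg_monomial (V : finType) E (a : V -> nat) :
  (forall i, a i <= E)%N -> polydeg E (fun x : V -> R => \prod_i x i ^+ a i).
Proof.
move=> aE; exists (fun b => (b == [ffun i => inord (a i)])%:R) => x.
rewrite (bigD1 [ffun i => inord (a i)]) //= eqxx mul1r.
rewrite [X in _ + X]big1 ?addr0 => [|b /negbTE b_neq]; last first.
  by rewrite b_neq mul0r.
by apply: eq_bigr => i _; rewrite ffunE inordK // ltnS.
Qed.

Lemma polydeg0 (V : finType) E : @polydeg V E (fun=> 0).
Proof. by exists (fun=> 0) => x; rewrite big1 // => a _; rewrite mul0r. Qed.

Lemma polydegD (V : finType) E (f g : (V -> R) -> R) :
  polydeg E f -> polydeg E g -> polydeg E (fun x => f x + g x).
Proof.
move=> [c cP] [e eP]; exists (fun a => c a + e a) => x.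
by rewrite cP eP -big_split; apply: eq_bigr => a _; rewrite mulrDl.
Qed.

Lemma polydegZ (V : finType) E k (f : (V -> R) -> R) :
  polydeg E f -> polydeg E (fun x => k * f x).
Proof.
move=> [c cP]; exists (fun a => k * c a) => x.
by rewrite cP big_distrr /=; apply: eq_bigr => a _; rewrite mulrA.
Qed.

Lemma polydeg_sum (V : finType) E I (r : seq I) (P : pred I)
    (F : I -> (V -> R) -> R) :
  (forall i, P i -> polydeg E (F i)) ->
  polydeg E (fun x => \sum_(i <- r | P i) F i x).
Proof.
move=> FE; elim: r => [|i r IH].
  by apply: eq_polydeg (polydeg0 _ _) => x; rewrite big_nil.
case: (boolP (P i)) => Pi; last first.
  by apply: eq_polydeg IH => x; rewrite big_cons (negbTE Pi).
by apply: eq_polydeg (polydegD (FE i Pi) IH) => x; rewrite big_cons Pi.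
Qed.

Lemma polydegM (V : finType) E1 E2 (f g : (V -> R) -> R) :
  polydeg E1 f -> polydeg E2 g -> polydeg (E1 + E2) (fun x => f x * g x).
Proof.
move=> [c cP] [e eP].
apply: (@eq_polydeg _ _ (fun x => \sum_a \sum_b (c a * e b) *
   \prod_i x i ^+ (a i + b i))).
  move=> x; rewrite cP eP big_distrl /=; apply: eq_bigr => a _.
  rewrite big_distrr /=; apply: eq_bigr => b _.
  rewrite mulrACA -big_split /=; congr (_ * _).
  by apply: eq_bigr => i _; rewrite exprD.
apply: polydeg_sum => a _; apply: polydeg_sum => b _; apply: polydegZ.
by apply: polydeg_monomial => i; rewrite leq_add // -ltnS.
Qed.

Lemma polydeg_cst (V : finType) k : @polydeg V 0 (fun=> k).
Proof.
apply: (@eq_polydeg _ _ (fun x => k * \prod_(i : V) x i ^+ 0)).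
  by move=> x; rewrite big1 ?mulr1.
exact/polydegZ/polydeg_monomial.
Qed.

Lemma polydeg_var (V : finType) (v : V) : polydeg 1 (fun x : V -> R => x v).
Proof.
apply: (@eq_polydeg _ _ (fun x => \prod_(i : V) x i ^+ (i == v))).
  move=> x; rewrite (bigD1 v) //= eqxx expr1 big1 ?mulr1 // => i /negbTE->.
  by rewrite expr0.
by apply: polydeg_monomial => i; case: eqP.
Qed.

Lemma polydeg_le (V : finType) E E' (f : (V -> R) -> R) :
  (E <= E')%N -> polydeg E f -> polydeg E' f.
Proof.
move=> /subnKC <- fE; apply: eq_polydeg (polydegM fE _).
  by move=> x; exact: mulr1.
apply: eq_polydeg (polydeg_monomial (a := fun=> 0%N) _) => // x.
by rewrite big1.
Qed.

Lemma polydeg_prod (V I : finType) E (F : I -> (V -> R) -> R) :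
  (forall i, polydeg E (F i)) ->
  polydeg (#|I| * E) (fun x => \prod_i F i x).
Proof.
move=> FE; rewrite cardT enumT.
apply: (@eq_polydeg _ _ (fun x => \prod_(i <- enum I) F i x)).
  by move=> x; rewrite big_enum.
rewrite -enumT; elim: (enum I) => [|i r IH].
  by apply: eq_polydeg (polydeg_cst _ 1) => x; rewrite big_nil.
rewrite /= mulSn; apply: eq_polydeg (polydegM (FE i) IH) => x.
by rewrite big_cons.
Qed.

Lemma polydegX (V : finType) E n (f : (V -> R) -> R) :
  polydeg E f -> polydeg (n * E) (fun x => f x ^+ n).
Proof.
move=> fE; rewrite -[n in polydeg (n * _)]card_ord.
apply: eq_polydeg (polydeg_prod (fun=> fE)) => x.
by rewrite prodr_const card_ord.
Qed.

Definition polyfun (V : finType) (f : (V -> R) -> R) := exists E, polydeg E f.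

Lemma eq_polyfun (V : finType) (f g : (V -> R) -> R) :
  f =1 g -> polyfun f -> polyfun g.
Proof. by move=> fg [E /(eq_polydeg fg)]; exists E. Qed.

Lemma polyfun_cst (V : finType) k : @polyfun V (fun=> k).
Proof. by exists 0%N; exact: polydeg_cst. Qed.

Lemma polyfun_var (V : finType) (v : V) : polyfun (fun x : V -> R => x v).
Proof. by exists 1%N; exact: polydeg_var. Qed.

Lemma polyfunM (V : finType) (f g : (V -> R) -> R) :
  polyfun f -> polyfun g -> polyfun (fun x => f x * g x).
Proof. by move=> [E fE] [E' gE]; exists (E + E')%N; exact: polydegM. Qed.

Lemma polyfunD (V : finType) (f g : (V -> R) -> R) :
  polyfun f -> polyfun g -> polyfun (fun x => f x + g x).
Proof.
move=> [E fE] [E' gE]; exists (E + E')%N; apply: polydegD.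
  exact: polydeg_le (leq_addr _ _) fE.
exact: polydeg_le (leq_addl _ _) gE.
Qed.

Lemma polyfun_sum (V I : finType) (F : I -> (V -> R) -> R) :
  (forall i, polyfun (F i)) -> polyfun (fun x => \sum_i F i x).
Proof.
move=> /choice[E FE]; exists (\max_i E i)%N; apply: polydeg_sum => i _.
exact: polydeg_le (leq_bigmax _) (FE i).
Qed.

Lemma polyfun_prod (V I : finType) (F : I -> (V -> R) -> R) :
  (forall i, polyfun (F i)) -> polyfun (fun x => \prod_i F i x).
Proof.
move=> /choice[E FE]; exists (#|I| * \max_i E i)%N; apply: polydeg_prod => i.
exact: polydeg_le (leq_bigmax _) (FE i).
Qed.

Lemma polyfun_comp (V W : finType) (f : (W -> R) -> R)
    (y : W -> (V -> R) -> R) :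
  polyfun f -> (forall i, polyfun (y i)) -> polyfun (fun x => f (y ^~ x)).
Proof.
move=> [E [c cP]] yP; apply: eq_polyfun (fun x => esym (cP (y ^~ x))) _.
apply: polyfun_sum => a; apply: polyfunM; first exact: polyfun_cst.
apply: polyfun_prod => i; have [E' yE] := yP i.
by exists (a i * E')%N; exact: polydegX.
Qed.

(* The D ^ #|I| points of the grid are separated by functions that pull back
   to polynomials spanning a space of dimension O(D ^ #|V|). *)
Lemma polyfun_avoid (V I J : finType) (phi : J -> (V -> R) -> I -> R)
    (eps : R) :
  (#|V| < #|I|)%N -> (forall j i, polyfun (fun x => phi j x i)) -> 0 < eps ->
  exists b : I -> R, (forall i, `|b i| <= eps) /\
    forall j x, exists i, phi j x i <> b i.
Proof.
move=> VI phiP eps0.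
have [e eP] : exists e, forall j i, polydeg e (fun x => phi j x i).
  have /choice[E EP] : forall ji : J * I, exists E,
      polydeg E (fun x => phi ji.1 x ji.2).
    by move=> [j i]; exact: phiP.
  exists (\max_ji E ji)%N => j i; apply: polydeg_le (EP (j, i)).
  exact: (leq_bigmax (j, i)).
apply: contrapT => no.
(* [D] exceeds #|J| (n e + 1)^#|V|, as the final count requires; [N] bounds the degree of a Lagrange
   function (n D factors) pulled back along maps of degree e. *)
pose n := #|I|; pose D := (#|J| * (n * e).+1 ^ #|V|).+1.
pose G := {ffun I -> 'I_D}; pose N := (n * (D * e))%N.
pose pt (a : 'I_D) : R := eps * a%:R / D%:R.
have pt_inj : injective pt.
  have D0 : D%:R^-1 != 0 :> R by rewrite invr_eq0 pnatr_eq0.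
  have e0 : eps != 0 by rewrite gt_eqF.
  move=> a a' /(mulIf D0) /(mulfI e0) /eqP; rewrite eqr_nat => /eqP.
  exact: val_inj.
have /choice[jx jxP] : forall g : G, exists jx : J * (V -> R),
    forall i, phi jx.1 jx.2 i = pt (g i).
  move=> g; apply: contrapT => H; apply: no; exists (fun i => pt (g i)).
  split=> [i|j x].
    rewrite ger0_norm ?divr_ge0 ?mulr_ge0 ?(ltW eps0) //.
    by rewrite ler_pdivrMr // ler_pM2l // ler_nat ltnW.
  apply: contrapT => H'; apply: H; exists (j, x) => i /=.
  by apply: contrapT => H''; apply: H'; exists i.
(* The Lagrange basis of the grid: [lag g] is 1 at the point [g] and 0 at the others. *)
pose lag (g : G) (y : I -> R) := \prod_i \prod_(a < D)
   (if a == g i then 1 else (pt (g i) - pt a)^-1 * (y i - pt a)).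
have lagP (g h : G) : lag g (fun i => pt (h i)) = (h == g)%:R.
  have [->|hg] := eqVneq h g.
    rewrite /lag big1 // => i _; rewrite big1 // => a _.
    case: eqVneq => // ag; rewrite mulVf // subr_eq0 (inj_eq pt_inj).
    by rewrite eq_sym.
  have [i hgi] : exists i, h i != g i.
    apply/existsP; rewrite -negb_forall; apply: contra hg => /forallP H.
    by apply/eqP/ffunP => i; exact/eqP.
  rewrite /lag (bigD1 i) //= (bigD1 (h i)) //= (negbTE hgi) subrr mulr0.
  by rewrite !mul0r.
have /choice[c cP] : forall jg : J * G, exists c : {ffun V -> 'I_N.+1} -> R,
    forall x, lag jg.2 (phi jg.1 x) = \sum_a c a * \prod_i x i ^+ a i.
  move=> [j g] /=; rewrite -/(polydeg N (fun x => lag g (phi j x))).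
  apply: polydeg_prod => i; rewrite -[D in (D * e)%N]card_ord.
  apply: polydeg_prod => a; case: eqP => _.
    exact: polydeg_le (polydeg_cst _ _).
  apply: polydegZ; apply: polydegD => //.
  exact: polydeg_le (polydeg_cst _ _).
pose C := (J * {ffun V -> 'I_N.+1})%type.
(* [W] evaluates monomials at the chosen preimages of grid points, and [X] holds the coefficients of
   the pulled-back Lagrange functions. Their product is the identity of size #|G|, which therefore
   cannot exceed #|C|. *)
pose W := \matrix_(g < #|G|, k < #|{: C}|)
   (((enum_val k).1 == (jx (enum_val g)).1)%:R *
    \prod_i (jx (enum_val g)).2 i ^+ (enum_val k).2 i : R).
pose X := \matrix_(k < #|{: C}|, g < #|G|)
   (c ((enum_val k).1, enum_val g) (enum_val k).2 : R).
have WX : W *m X = 1%:M.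
  apply/matrixP => g h; rewrite !mxE.
  under eq_bigr do rewrite !mxE.
  pose F (j : J) (a : {ffun V -> 'I_N.+1}) := (j == (jx (enum_val g)).1)%:R *
    \prod_i (jx (enum_val g)).2 i ^+ a i * c (j, enum_val h) a.
  transitivity (\sum_(k in {: C}) F k.1 k.2).
    by rewrite (big_enum_val (fun k : C => F k.1 k.2)).
  rewrite -(pair_bigA _ F) /= /F.
  rewrite (bigD1 (jx (enum_val g)).1) //= [X in _ + X]big1 ?addr0; last first.
    by move=> j /negbTE->; apply: big1 => a _; rewrite !mul0r.
  rewrite -(inj_eq (@enum_val_inj _ _)) -lagP.
  transitivity (lag (enum_val h) (phi (jx (enum_val g)).1 (jx (enum_val g)).2)).
    rewrite (cP (_, _)); apply: eq_bigr => a _.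
    by rewrite eqxx mul1r mulrC.
  congr (lag _ _); apply/funext => i; exact: jxP.
have := mulmx1_min WX; rewrite card_prod !card_ffun !card_ord leqNgt => /negP[].
have hN : (N.+1 <= D * (n * e).+1)%N.
  by rewrite /N mulnCA [leqRHS]mulnS -addn1 addnC leq_add2r.
apply: (@leq_ltn_trans (#|J| * (D * (n * e).+1) ^ #|V|)).
  rewrite leq_mul2l; apply/orP; right.
  by case: #|V| => // m; rewrite leq_exp2r.
apply: (@leq_trans (D ^ #|V|.+1)); last exact: leq_pexp2l.
by rewrite expnMn mulnCA expnS mulnC ltn_pmul2r ?expn_gt0.
Qed.
End PolynomialFunctions.

(** * Covering the nilpotent matrices, and perturbing off them *)

Section NilpotentCover.
Variable R : realType.

Definition polymx (V : finType) m n (F : (V -> R) -> 'M[R]_(m, n)) :=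
  forall i j, polyfun (fun x => F x i j).

Lemma polymx_cst (V : finType) m n (A : 'M[R]_(m, n)) :
  @polymx V _ _ (fun=> A).
Proof. by move=> i j; exact: polyfun_cst. Qed.

Lemma polymxM (V : finType) m n p (F : (V -> R) -> 'M[R]_(m, n))
    (G : (V -> R) -> 'M[R]_(n, p)) :
  polymx F -> polymx G -> polymx (fun x => F x *m G x).
Proof.
move=> FP GP i j; apply: (@eq_polyfun _ _ (fun x => \sum_k F x i k * G x k j)).
  by move=> x; rewrite mxE.
by apply: polyfun_sum => k; exact: polyfunM.
Qed.

Lemma polymxD (V : finType) m n (F G : (V -> R) -> 'M[R]_(m, n)) :
  polymx F -> polymx G -> polymx (fun x => F x + G x).
Proof.
move=> FP GP i j; apply: (@eq_polyfun _ _ (fun x => F x i j + G x i j)).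
  by move=> x; rewrite mxE.
exact: polyfunD.
Qed.

Lemma polymxN (V : finType) m n (F : (V -> R) -> 'M[R]_(m, n)) :
  polymx F -> polymx (fun x => - F x).
Proof.
move=> FP i j; apply: (@eq_polyfun _ _ (fun x => -1 * F x i j)).
  by move=> x; rewrite mxE mulN1r.
by apply: polyfunM => //; exact: polyfun_cst.
Qed.

Lemma polymx_block (V : finType) m1 m2 n1 n2
    (F : (V -> R) -> 'M[R]_(m1, n1)) (G : (V -> R) -> 'M[R]_(m1, n2))
    (H : (V -> R) -> 'M[R]_(m2, n1)) (K : (V -> R) -> 'M[R]_(m2, n2)) :
  polymx F -> polymx G -> polymx H -> polymx K ->
  polymx (fun x => block_mx (F x) (G x) (H x) (K x)).
Proof.
move=> FP GP HP KP a b; rewrite -[a]splitK -[b]splitK.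
case: (fintype.split a) => i'; case: (fintype.split b) => j' /=.
- by apply: eq_polyfun (FP i' j') => x; rewrite block_mxEul.
- by apply: eq_polyfun (GP i' j') => x; rewrite block_mxEur.
- by apply: eq_polyfun (HP i' j') => x; rewrite block_mxEdl.
- by apply: eq_polyfun (KP i' j') => x; rewrite block_mxEdr.
Qed.

Lemma polymx_comp (V W : finType) m n (F : (W -> R) -> 'M[R]_(m, n))
    (s : W -> V) :
  polymx F -> polymx (fun x : V -> R => F (x \o s)).
Proof.
move=> FP i j.
have := @polyfun_comp R V W (fun x => F x i j) (fun k x => x (s k)) (FP i j).
by apply=> k; exact: polyfun_var.
Qed.

Lemma det_scalar_sub_conj d (G H B : 'M[R]_d) x : G *m H = 1%:M ->
  \det (x%:M - H *m B *m G) = \det (x%:M - B).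
Proof.
move=> GH; have HG := mulmx1C GH.
have -> : x%:M - H *m B *m G = H *m (x%:M - B) *m G.
  by rewrite mulmxBr mulmxBl scalar_mxC -[_ *m H *m G]mulmxA HG mulmx1.
by rewrite !det_mulmx mulrAC -det_mulmx HG det1 mul1r.
Qed.

(** Its first row is (1, w): the change of basis that takes a left null vector of this form to the
    first coordinate row. *)
Definition shear d (w : 'rV[R]_d) : 'M[R]_(1 + d) := block_mx 1%:M w 0 1%:M.

Lemma shearK d (w : 'rV[R]_d) : shear w *m shear (- w) = 1%:M.
Proof.
rewrite /shear mulmx_block !mul1mx !mulmx1 !mul0mx !mulmx0 !addr0 add0r addNr.
by rewrite -scalar_mx_block.
Qed.

(* A left null vector, normalised to have a coordinate equal to 1, splits off
   the first row. *)
Lemma nilpotent_deflate d (A : 'M[R]_(1 + d)) : char_poly A = 'X^(1 + d) ->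
  exists i (w : 'rV[R]_d) (u : 'cV[R]_d) (B : 'M[R]_d),
    char_poly B = 'X^d /\
    A = tperm_mx i 0 *m (shear (- w) *m block_mx 0 0 u B *m shear w) *m
        tperm_mx i 0.
Proof.
move=> AX; have detA x : \det (x%:M - A) = x ^+ (1 + d).
  by rewrite -horner_char_poly AX hornerXn.
have /det0P[v v0 vA] : \det A == 0.
  have /eqP := detA 0; rewrite expr0n /= => /det0P[v v0 vA].
  apply/det0P; exists v => //; apply/eqP; rewrite -oppr_eq0 -mulmxN.
  by rewrite -[- A]sub0r -{1}(raddf0 (@scalar_mx R (1 + d))) vA.
have [i vi] : exists i, v 0 i != 0.
  apply/existsP; rewrite -negb_forall; apply: contra v0 => /forallP H.
  by apply/eqP/rowP => i; rewrite mxE; exact/eqP.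
pose P : 'M[R]_(1 + d) := tperm_mx i 0.
have PP : P *m P = 1%:M.
  by rewrite /P -perm_mxM perm.tperm2 perm_mx1.
pose v1 := (v 0 i)^-1 *: v *m P.
have v1E : v1 = row_mx 1%:M (rsubmx v1).
  rewrite -[LHS]hsubmxK; congr row_mx; apply/matrixP => a b.
  rewrite !ord1 mxE /v1 /P -xcolE !mxE eqxx mulr1n /=.
  rewrite (_ : lshift d 0 = 0); last exact/val_inj.
  by rewrite perm.tpermR mulVf.
pose A1 := P *m A *m P.
have AE : A = P *m A1 *m P by rewrite /A1 !mulmxA PP mul1mx -mulmxA PP mulmx1.
have v1A : v1 *m A1 = 0.
  rewrite /A1 /v1 !mulmxA -[_ *m P *m P]mulmxA PP mulmx1 -!scalemxAl vA.
  by rewrite mul0mx scaler0.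
set w := rsubmx v1 in v1E.
pose u : 'cV[R]_d := dlsubmx A1; pose B := drsubmx A1 - u *m w.
have A1E : A1 = shear (- w) *m block_mx 0 0 u B *m shear w.
  move: v1A; rewrite v1E -[A1 in _ *m A1]submxK mul_row_block !mul1mx.
  move=> v1A; have /eq_row_mx[e1 e2] := etrans v1A (esym (row_mx0 _ _ _ _)).
  rewrite /shear !mulmx_block !mul1mx !mulmx1 !mul0mx !mulmx0 !add0r !addr0.
  rewrite -[LHS]submxK -/u; congr block_mx.
  - by apply/eqP; rewrite mulNmx -addr_eq0 e1.
  - rewrite /B mulmxBr -mulmxA addrC subrK mulNmx.
    by apply/eqP; rewrite -addr_eq0 e2.
  - by rewrite /B addrC subrK.
exists i, w, u, B; split; last by rewrite -A1E.
(* The block form gives \det (x - A) = x \det (x - B), and x is cancelled. *)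
apply: char_poly_eqXn => x x0; apply: (mulfI x0); rewrite -exprS -(detA x) AE.
rewrite (det_scalar_sub_conj _ _ PP) A1E det_scalar_sub_conj ?shearK //.
rewrite scalar_mx_block opp_block_mx add_block_mx !oppr0 !add0r !addr0.
by rewrite det_lblock det_scalar expr1.
Qed.

(** Passing from size d to d + 1 adds the 2 d entries of [w] and [u], and d (d - 1) + 2 d = (d + 1)
    d. The pivot index takes finitely many values and goes into [J]. *)
Lemma nilpotent_cover d :
  exists (V J : finType) (phi : J -> (V -> R) -> 'M[R]_d),
  [/\ #|V| = (d * d.-1)%N, forall j, polymx (phi j) &
    forall A : 'M[R]_d, char_poly A = 'X^d -> exists j x, A = phi j x].
Proof.
elim: d => [|d [V [J [phi [VE phiP phiA]]]]].
  exists 'I_0, unit, (fun _ _ => 0); split=> [|_|A _].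
    by rewrite card_ord.
    exact: polymx_cst.
  by exists tt, (fun=> 0); apply/matrixP => -[].
pose psi (ij : 'I_(1 + d) * J) (x : ('I_d + 'I_d) + V -> R) : 'M[R]_(1 + d) :=
  let w := \row_k x (inl (inl k)) in
  let u := \col_k x (inl (inr k)) in
  tperm_mx ij.1 0 *m (shear (- w) *m
    block_mx 0 0 u (phi ij.2 (x \o inr)) *m shear w) *m tperm_mx ij.1 0.
exists (('I_d + 'I_d) + V)%type, ('I_(1 + d) * J)%type, psi; split.
- by rewrite !card_sum card_ord VE; case: (d) => //= k; lia.
- move=> [i j]; rewrite /psi /=.
  have wP : polymx (fun x : 'I_d + 'I_d + V -> R => \row_k x (inl (inl k))).
    move=> a b; apply: (@eq_polyfun _ _ (fun x => x (inl (inl b)))).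
      by move=> x; rewrite mxE.
    exact: polyfun_var.
  have uP : polymx (fun x : 'I_d + 'I_d + V -> R => \col_k x (inl (inr k))).
    move=> a b; apply: (@eq_polyfun _ _ (fun x => x (inl (inr a)))).
      by move=> x; rewrite mxE.
    exact: polyfun_var.
  have cP m n (M : 'M[R]_(m, n)) := polymx_cst ('I_d + 'I_d + V)%type M.
  have sP (w : ('I_d + 'I_d + V -> R) -> 'rV[R]_d) :
      polymx w -> polymx (fun x => shear (w x)).
    by move=> wP'; exact: polymx_block.
  have bP := polymx_block (cP 1%N 1%N 0) (cP 1%N d 0) uP
    (polymx_comp inr (phiP j)).
  have M1 := polymxM (sP _ (polymxN wP)) bP.
  have M2 := polymxM M1 (sP _ wP).
  exact: (polymxM (polymxM (cP _ _ (tperm_mx i 0)) M2) (cP _ _ (tperm_mx i 0))).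
- move=> A /nilpotent_deflate[i [w [u [B [BX ->]]]]].
  have [j [x Bx]] := phiA B BX.
  pose y (k : 'I_d + 'I_d + V) := match k with
    | inl (inl k) => w 0 k | inl (inr k) => u k 0 | inr k => x k end.
  exists (i, j), y; rewrite /psi.
  have -> : \row_k y (inl (inl k)) = w by apply/rowP => k; rewrite mxE.
  have -> : \col_k y (inl (inr k)) = u by apply/colP => k; rewrite mxE.
  by rewrite Bx.
Qed.

(** If psi + b is nilpotent then b = phi - psi for some chart phi of the cover. These differences
    are polynomial in d (d - 1) + #|W| < d^2 variables, so [polyfun_avoid] yields a small b outside
    all their images. *)
Lemma non_nilpotent_perturbation d (W J : finType)
    (psi : J -> (W -> R) -> 'M[R]_d) (eps : R) :
  (#|W| < d)%N -> (forall j, polymx (psi j)) -> 0 < eps ->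
  exists2 b : 'M[R]_d, frob b <= eps &
    forall j y, char_poly (psi j y + b) <> 'X^d.
Proof.
move=> Wd psiP eps0; have [V [K [phi [VE phiP phiA]]]] := nilpotent_cover d.
pose chi (kj : K * J) (x : V + W -> R) (ab : 'I_d * 'I_d) :=
  (phi kj.1 (x \o inl) - psi kj.2 (x \o inr)) ab.1 ab.2.
have [|||b [b_le bP]] := @polyfun_avoid R (V + W)%type ('I_d * 'I_d)%type
  (K * J)%type chi (eps / (d * d)%:R).
- rewrite card_sum card_prod card_ord VE; case: (d) Wd => // k; lia.
- move=> [k j] [a c]; apply: (polymxD (F := fun x => phi k (x \o inl))) => /=.
    exact: polymx_comp.
  by apply: polymxN; exact: polymx_comp.
- rewrite divr_gt0 // ltr0n muln_gt0; case: (d) Wd => //.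
exists (\matrix_(i, j) b (i, j)).
  apply: le_trans (frob_le_sum _) _.
  have d0 : (0 < d)%N by apply: leq_ltn_trans Wd.
  apply: (@le_trans _ _ (\sum_(i < d) \sum_(j < d) (eps / (d * d)%:R))).
    by apply: ler_sum => i _; apply: ler_sum => j _; rewrite mxE.
  rewrite !sumr_const !card_ord -mulrnA -(mulr_natr (eps / _)) divfK //.
  by rewrite pnatr_eq0 -lt0n muln_gt0 d0.
move=> j y /phiA[k [x E]].
have [[a c] /=] := bP (k, j)
  (fun v => match v with inl v => x v | inr v => y v end).
apply; rewrite /chi /=.
rewrite (_ : phi k _ = phi k x) // -E (_ : psi j _ = psi j y) //.
by rewrite addrC addKr mxE.
Qed.
End NilpotentCover.

(** * Interpolation on the cube *)

Local Open Scope classical_set_scope.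

Section HatFunctions.
Variable R : realType.

(* [max 0 (1 - |y|)] *)
Definition hat (y : R) : R := (`|1 - `|y| | + (1 - `|y|)) / 2.

Lemma hat_ge0 y : 0 <= hat y.
Proof.
by rewrite divr_ge0 //; have := ler_norm (- (1 - `|y|)); rewrite normrN; lra.
Qed.

Lemma hat_eq0 y : 1 <= `|y| -> hat y = 0.
Proof. by move=> y1; rewrite /hat ler0_norm ?subr_le0 //; lra. Qed.

Lemma hatE y : `|y| <= 1 -> hat y = 1 - `|y|.
Proof. by move=> y1; rewrite /hat ger0_norm ?subr_ge0 //; lra. Qed.

Lemma continuous_hat : continuous hat.
Proof.
move=> y; apply: cvgM; last exact: cvg_cst.
have h : (1 - `|z|) @[z --> y] --> 1 - `|y|.
  by apply: cvgB; [exact: cvg_cst | apply: cvg_norm; exact: cvg_id].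
by apply: cvgD => //; exact: cvg_norm.
Qed.

(** The affine function that agrees with hat (y - v) on the cell [c, c + 1]; it makes the
    interpolant polynomial cell by cell. *)
Definition cell_hat (c v : nat) (y : R) : R :=
  if v == c then 1 - (y - c%:R) else if v == c.+1 then y - c%:R else 0.

Lemma hat_cell (c v : nat) y : c%:R <= y <= c.+1%:R ->
  hat (y - v%:R) = cell_hat c v y.
Proof.
move=> /andP[cy yc]; rewrite /cell_hat.
have cS : c.+1%:R = c%:R + 1 :> R by rewrite natr1.
case: eqVneq => [->|vc].
  by rewrite hatE ger0_norm ?subr_ge0 //; lra.
case: eqVneq => [->|vc'].
  by rewrite hatE ler0_norm ?subr_le0 //; lra.
apply: hat_eq0; case: (ltngtP v c) vc => // [vlt|vgt] _.
  have : v.+1%:R <= c%:R :> R by rewrite ler_nat.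
  by rewrite -natr1 => ?; rewrite ger0_norm; lra.
have : c.+2%:R <= v%:R :> R by rewrite ler_nat; lia.
by rewrite -natr1 => ?; rewrite ler0_norm; lra.
Qed.

Lemma unit_cell_exists K (y : R) : 0 <= y <= K.+1%:R ->
  exists2 c : 'I_K.+1, c%:R <= y & y <= c.+1%:R.
Proof.
elim: K => [|K IH] /andP[y0 yK]; first by exists ord0.
have [yK'|yK'] := lerP y K.+1%:R.
  by have [|c c1 c2] := IH; [rewrite y0 | exists (widen_ord (leqnSn _) c)].
by exists ord_max => //; exact: ltW.
Qed.

Lemma sum_hat K (y : R) : 0 <= y <= K.+1%:R ->
  \sum_(v < K.+2) hat (y - v%:R) = 1.
Proof.
move=> /unit_cell_exists[c cy yc].
under eq_bigr => v _ do rewrite (@hat_cell c) ?cy ?yc //.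
rewrite (bigD1 (widen_ord (leqnSn _) c)) //=.
rewrite (bigD1 (lift ord0 c)) /=; last first.
  by rewrite -val_eqE /= /bump /= add1n; lia.
rewrite big1 => [|v /andP[v1 v2]].
  rewrite /cell_hat eqxx /bump /= add1n eqxx; case: eqP => [|_]; first lia.
  by rewrite addr0 subrK.
rewrite /cell_hat; move: v1 v2; rewrite -!val_eqE /= /bump /= add1n.
by move=> /negbTE-> /negbTE->.
Qed.

Lemma polyfun_cell_hat (V : finType) c v K (i : V) :
  polyfun (fun y : V -> R => cell_hat c v (K * y i)).
Proof.
have yP : polyfun (fun y : V -> R => K * y i).
  by apply: polyfunM; [exact: polyfun_cst | exact: polyfun_var].
have ycP : polyfun (fun y : V -> R => K * y i - c%:R).
  by apply: polyfunD => //; exact: polyfun_cst.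
rewrite /cell_hat; case: eqP => _; last first.
  by case: eqP => _ //; exact: polyfun_cst.
apply: (@eq_polyfun _ _ (fun y => 1 + -1 * (K * y i - c%:R))).
  by move=> y; rewrite mulN1r.
by apply: polyfunD; [|apply: polyfunM => //]; exact: polyfun_cst.
Qed.

End HatFunctions.

(** * Continuity of matrix maps, clamping and compactness of the cube *)

Section MatrixContinuity.
Variable R : realType.

Lemma cvg_mx T (F : set_system T) m n (G : T -> 'M[R]_(m, n))
    (L : 'M[R]_(m, n)) :
  Filter F -> (forall i j, G x i j @[x --> F] --> L i j) ->
  G x @[x --> F] --> L.
Proof.
move=> FF H A [P hP sPA].
have : F [set x | forall i j, P i j (G x i j)].
  by apply: filter_forall => i; apply: filter_forall => j; exact/H/hP.
by apply: (@filterS _ F) => x Px; exact: sPA.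
Qed.

Lemma continuous_mx (T : topologicalType) m n (G : T -> 'M[R]_(m, n)) :
  (forall i j, continuous (fun x => G x i j)) -> continuous G.
Proof.
by move=> H x; apply: (@cvg_mx _ (nbhs x)) => i j; exact: H.
Qed.

Lemma continuous_compose (S T U : topologicalType) (f : S -> T) (g : T -> U) :
  continuous f -> continuous g -> continuous (fun x => g (f x)).
Proof. by move=> fc gc x; exact: cvg_comp (fc x) (gc _). Qed.

Lemma continuous_frob m n : continuous (fun A : 'M[R]_(m, n) => frob A).
Proof.
move=> A.
have FA : Filter (nbhs A) by exact: nbhs_filter.
apply: (iffRL (@cvgrPdist_le R R _ (nbhs A) FA (fun B => frob B) (frob A))).
move=> e e0; have := (cvg_frobP id A (nbhs_filter A)).1 cvg_id e e0.
apply: filterS => B AB; apply: le_trans AB.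
rewrite ler_norml; have := frobD (A - B) B; have := frobD (B - A) A.
by rewrite !subrK (frob_distC B); lra.
Qed.

(** The retraction of the line onto [0, 1], written with absolute values so that continuity is
    immediate. *)
Definition clamp1 (y : R) : R := (`|y| - `|y - 1| + 1) / 2.

Lemma clamp1_itv y : 0 <= clamp1 y <= 1.
Proof.
rewrite /clamp1; case: (ger0P y) => y0; case: (ger0P (y - 1)) => y1; lra.
Qed.

Lemma clamp1_id y : 0 <= y <= 1 -> clamp1 y = y.
Proof.
move=> /andP[y0 y1].
by rewrite /clamp1 ger0_norm // ler0_norm ?subr_le0 //; lra.
Qed.

Lemma clamp1_le0 y : y <= 0 -> clamp1 y = 0.
Proof. by move=> y0; rewrite /clamp1 ler0_norm // ler0_norm; lra. Qed.

Lemma clamp1_ge1 y : 1 <= y -> clamp1 y = 1.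
Proof. by move=> y1; rewrite /clamp1 ger0_norm ?ger0_norm; lra. Qed.

Lemma continuous_clamp1 : continuous clamp1.
Proof.
move=> y; apply: cvgM; last exact: cvg_cst.
apply: cvgD; last exact: cvg_cst.
apply: cvgB; first by apply: cvg_norm; exact: cvg_id.
by apply: cvg_norm; apply: cvgB; [exact: cvg_id | exact: cvg_cst].
Qed.

Definition clamp k (s : 'rV[R]_k) : 'rV[R]_k := map_mx clamp1 s.

Lemma clamp_cube k (s : 'rV[R]_k) : cube R k (clamp s).
Proof. by move=> i; rewrite mxE clamp1_itv. Qed.

Lemma clamp_id k (s : 'rV[R]_k) : cube R k s -> clamp s = s.
Proof. by move=> sI; apply/rowP => i; rewrite mxE clamp1_id. Qed.

Lemma continuous_clamp k : continuous (@clamp k).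
Proof.
apply: continuous_mx => i j; under eq_fun do rewrite mxE.
exact: (continuous_compose (@coord_continuous R 1 k i j) continuous_clamp1).
Qed.

(** Trades continuity within the cube for continuity everywhere, so that later constructions handle
    total continuous maps. *)
Lemma continuous_comp_clamp k (X : topologicalType) (f : 'rV[R]_k -> X) :
  {within cube R k, continuous f} -> continuous (f \o @clamp k).
Proof.
move=> /subspace_continuousP fc s.
apply: cvg_comp (fc _ (clamp_cube s)) => A hA.
have := @continuous_clamp k s _ hA.
by apply: (@filterS _ (nbhs s) (nbhs_filter s)) => u; apply; exact: clamp_cube.
Qed.

Lemma cube_compact k : compact (cube R k).
Proof.
rewrite (_ : cube R k = [set s | forall i, `[0, 1]%classic (s ord0 i)]).
  have H (i : 'I_k) : compact `[0 : R, 1]%classic by exact: segment_compact.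
  exact: (rV_compact H).
by apply/seteqP; split=> s /= H i; have := H i; rewrite in_itv.
Qed.

Lemma cube_uniform_continuity k m n (F : 'rV[R]_k -> 'M[R]_(m, n)) (e : R) :
  continuous F -> 0 < e -> exists2 del : R, 0 < del &
    forall u v : 'rV[R]_k, cube R k u ->
    (forall i, `|u ord0 i - v ord0 i| <= del) -> frob (F u - F v) <= e.
Proof.
move=> Fc e0; pose P (del : R) (u : 'rV[R]_k) := forall v : 'rV[R]_k,
  (forall i, `|u ord0 i - v ord0 i| <= del) -> frob (F u - F v) <= e.
have /compact_near_coveringP/(_ R (0^'+) P _) := @cube_compact k.
case=> [u _|eps /= eps0 H].
  have e2 : 0 < e / 2 by lra.
  have /nbhs_ballP[eta /= eta0 Heta] :=
    (cvg_frobP _ _ (nbhs_filter u)).1 (Fc u) _ e2.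
  have eta2 : 0 < eta / 2 by lra.
  exists (ball u (eta / 2), [set del | del < eta / 2]) => /=.
    split; first exact: nbhsx_ballx.
    exact: nbhs_right_lt.
  move=> [u' del] /= [[_ uu'] del_lt] v Hv.
  have h1 : frob (F u - F u') <= e / 2.
    apply: Heta; split=> // i j; apply: le_ball (uu' i j); lra.
  have h2 : frob (F u - F v) <= e / 2.
    apply: Heta; split=> // i j; rewrite (ord1 i).
    have := uu' ord0 j; have := Hv j; rewrite /ball /=.
    have := ler_normD (u ord0 j - u' ord0 j) (u' ord0 j - v ord0 j).
    rewrite subrKA; lra.
  have := frob_dist_triangle (F u) (F u') (F v).
  rewrite (frob_distC _ (F u)); lra.
exists (eps / 2); first by lra.
move=> u v uI; apply: (H (eps / 2)) => //=; last by lra.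
by rewrite sub0r normrN ger0_norm; lra.
Qed.
End MatrixContinuity.

(** * Multilinear interpolation on a cubical grid *)

Section Interpolation.
Variables (R : realType) (q d K : nat) (F : 'rV[R]_q -> 'M[R]_d).

Definition grid_point (v : {ffun 'I_q -> 'I_K.+2}) : 'rV[R]_q :=
  \row_i ((v i)%:R / K.+1%:R).

Definition interp_weight (v : {ffun 'I_q -> 'I_K.+2}) (u : 'rV[R]_q) : R :=
  \prod_i hat (K.+1%:R * u ord0 i - (v i)%:R).

Definition interp (u : 'rV[R]_q) : 'M[R]_d :=
  \sum_v interp_weight v u *: F (grid_point v).

Definition cell_interp (c : {ffun 'I_q -> 'I_K.+1}) (y : 'I_q -> R) : 'M[R]_d :=
  \sum_(v : {ffun 'I_q -> 'I_K.+2})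
    (\prod_i cell_hat (c i) (v i) (K.+1%:R * y i)) *: F (grid_point v).

Let scaled_cube u i : cube R q u -> 0 <= K.+1%:R * u ord0 i <= K.+1%:R.
Proof.
move=> /(_ i)/andP[u0 u1]; rewrite mulr_ge0 //=.
by rewrite -[leRHS]mulr1 ler_wpM2l.
Qed.

Lemma interp_cell u : cube R q u -> exists c, interp u = cell_interp c (u ord0).
Proof.
move=> uI; have /choice[c cP] : forall i, exists c : 'I_K.+1,
    c%:R <= K.+1%:R * u ord0 i <= c.+1%:R.
  move=> i; have [c c1 c2] := unit_cell_exists (scaled_cube i uI).
  by exists c; rewrite c1 c2.
exists [ffun i => c i]; apply: eq_bigr => v _; congr (_ *: _).
by apply: eq_bigr => i _; rewrite ffunE; exact: hat_cell.
Qed.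

Lemma polymx_cell_interp c : polymx (cell_interp c).
Proof.
move=> a b; apply: (@eq_polyfun _ _ (fun y => \sum_(v : {ffun 'I_q -> 'I_K.+2})
    (\prod_i cell_hat (c i) (v i) (K.+1%:R * y i)) * F (grid_point v) a b)).
  by move=> y; rewrite summxE; apply: eq_bigr => v _; rewrite mxE.
apply: polyfun_sum => v; apply: polyfunM; last exact: polyfun_cst.
by apply: polyfun_prod => i; exact: polyfun_cell_hat.
Qed.

Lemma sum_interp_weight u : cube R q u -> \sum_v interp_weight v u = 1.
Proof.
move=> uI; rewrite -(bigA_distr_bigA (fun i (j : 'I_K.+2) =>
  hat (K.+1%:R * u ord0 i - j%:R))) big1 // => i _.
exact/sum_hat/scaled_cube.
Qed.

Lemma interp_weight_ge0 v u : 0 <= interp_weight v u.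
Proof. by apply: prodr_ge0 => i _; exact: hat_ge0. Qed.

(** The interpolant is a convex combination of grid values, and a nonzero weight forces its grid
    point within 1 / (K + 1) of [u] in each coordinate. *)
Lemma interp_close (e del : R) u : cube R q u -> K.+1%:R^-1 <= del ->
  (forall v : 'rV[R]_q, (forall i, `|u ord0 i - v ord0 i| <= del) ->
    frob (F u - F v) <= e) ->
  frob (interp u - F u) <= e.
Proof.
move=> uI Kdel H.
have -> : interp u - F u =
    \sum_v interp_weight v u *: (F (grid_point v) - F u).
  under [RHS]eq_bigr do rewrite scalerBr.
  by rewrite sumrB -scaler_suml sum_interp_weight // scale1r.
apply: le_trans (frob_sum _ _ _) _.
rewrite -[leRHS]mul1r -(sum_interp_weight uI) mulr_suml; apply: ler_sum => v _.
rewrite frobZ ger0_norm ?interp_weight_ge0 //.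
have [->|w0] := eqVneq (interp_weight v u) 0; first by rewrite !mul0r.
rewrite ler_wpM2l ?interp_weight_ge0 // frob_distC; apply: H => i.
rewrite mxE; have K0 : 0 < K.+1%:R :> R by [].
have : `|K.+1%:R * u ord0 i - (v i)%:R| < 1.
  rewrite ltNge; apply: contra w0 => /hat_eq0 h.
  by rewrite /interp_weight (bigD1 i) //= h mul0r.
have -> : K.+1%:R * u ord0 i - (v i)%:R =
    K.+1%:R * (u ord0 i - (v i)%:R / K.+1%:R).
  by rewrite mulrBr mulrCA mulfV ?mulr1 // gt_eqF.
rewrite normrM gtr0_norm // mulrC -ltr_pdivlMr // div1r => /ltW h.
exact: le_trans h Kdel.
Qed.

Lemma continuous_interp : continuous interp.
Proof.
apply: continuous_mx => a b.
have -> : (fun u => interp u a b) =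
    (fun u => \sum_v interp_weight v u * F (grid_point v) a b).
  by apply/funext => u; rewrite summxE; apply: eq_bigr => v _; rewrite mxE.
apply: (@continuous_big R) => [|v _]; first exact: add_continuous.
have wc : continuous (interp_weight v).
  apply: (@continuous_big R) => [|i _]; first exact: mul_continuous.
  have lc : continuous (fun u : 'rV[R]_q => K.+1%:R * u ord0 i - (v i)%:R).
    move=> u; exact: (cvgB (cvgM (cvg_cst _) (@coord_continuous R 1 q ord0 i u))
      (cvg_cst _)).
  exact: continuous_compose lc (@continuous_hat R).
by move=> u; exact: (cvgM (wc u) (cvg_cst _)).
Qed.
End Interpolation.

(** * Moving a map of the cube off the nilpotent matrices *)

Section GeneralPosition.
Variable R : realType.

(** Interpolation accounts for half of [e]. The interpolant is polynomial on each of finitely many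
    cells, so one constant matrix [b] of norm at most e / 2 clears all cells at once and keeps
    continuity. *)
Lemma general_position q d (F : 'rV[R]_q -> 'M[R]_d) (e : R) :
  (q < d)%N -> continuous F -> 0 < e ->
  exists F' : 'rV[R]_q -> 'M[R]_d, continuous F' /\ forall u, cube R q u ->
    frob (F' u - F u) <= e /\ char_poly (F' u) <> 'X^d.
Proof.
move=> qd Fc e0; have e2 : 0 < e / 2 by lra.
have [del del0 H] := cube_uniform_continuity Fc e2.
pose K := Num.bound del^-1.
have Kdel : K.+1%:R^-1 <= del.
  rewrite invf_ple ?posrE // ltW // (lt_le_trans (archi_boundP _)) //.
    by rewrite invr_ge0 ltW.
  by rewrite ler_nat.
have [|||b b_le bP] := @non_nilpotent_perturbation R d 'I_q
    {ffun 'I_q -> 'I_K.+1} (@cell_interp R q d K F) (e / 2).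
- by rewrite card_ord.
- exact: polymx_cell_interp.
- exact: e2.
exists (fun u => interp K F u + b); split.
  by move=> u; exact: (cvgD (@continuous_interp R q d K F u) (cvg_cst _)).
move=> u uI; split.
  have h := interp_close uI Kdel (H u ^~ uI).
  have := frobD (interp K F u - F u) b; rewrite addrAC; lra.
by have [c ->] := interp_cell K F uI; exact: bP.
Qed.

Lemma char_poly_scale_nilpotent d (c : R) (A : 'M[R]_d) : c != 0 ->
  char_poly (c *: A) = 'X^d -> char_poly A = 'X^d.
Proof.
move=> c0 H; apply: char_poly_eqXn => x _.
apply: (mulfI (expf_neq0 d c0)); rewrite -detZ -exprMn scalerBr scale_scalar_mx.
by rewrite -horner_char_poly H hornerXn.
Qed.
End GeneralPosition.

(** * Homotopies inside the unit normal matrices *)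

Section Homotopy.
Variables (R : realType) (d : nat).

Lemma UN_scale (c : R) (A : 'M[R]_d) : real_normal A -> real_normal (c *: A).
Proof.
rewrite /real_normal => AN.
by rewrite [(c *: A)^T]linearZ /= -!scalemxAl -!scalemxAr AN.
Qed.

Lemma continuous_scale (T : topologicalType) (h : T -> R) (G : T -> 'M[R]_d) :
  continuous h -> continuous G -> continuous (fun u => h u *: G u).
Proof. by move=> hc Gc u; exact: (cvgZ (hc u) (Gc u)). Qed.

Lemma continuous_fst (S T : topologicalType) : continuous (@fst S T).
Proof. by case=> x y; exact: cvg_fst. Qed.

Lemma continuous_snd (S T : topologicalType) : continuous (@snd S T).
Proof. by case=> x y; exact: cvg_snd. Qed.

(** Retract and normalise a perturbed F / 2. Where [F] is already unit normal the perturbation is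
    off and F / 2 is fixed by the retraction, so normalising returns [F]. *)
Lemma normal_extension q (F : 'rV[R]_q -> 'M[R]_d) : (q < d)%N ->
  continuous F -> (forall u, frob (F u) <= 1) ->
  (forall u, cube_boundary R q u -> UN R d (F u)) ->
  exists N : 'rV[R]_q -> 'M[R]_d, [/\ continuous N, forall u, UN R d (N u) &
    forall u, cube R q u -> UN R d (F u) -> N u = F u].
Proof.
move=> qd Fc F1 Fbd; have [r [rN r_id r_unif r0]] := @normal_retraction R d.
have half0 : (0 : R) <= 2^-1 by [].
have half (A : 'M[R]_d) : frob (2^-1 *: A) = 2^-1 * frob A.
  by rewrite frobZ ger0_norm.
have r_cont (G : 'rV[R]_q -> 'M[R]_d) : continuous G ->
    (forall u, frob (G u) <= 1) -> continuous (fun u => r (G u)).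
  move=> Gc G1 u; apply: (iffRL (cvg_frobP _ _ (nbhs_filter u))) => e e0.
  have [del del0 H] := r_unif _ e0.
  have := (cvg_frobP _ _ (nbhs_filter u)).1 (Gc u) _ del0.
  by apply: filterS => v; exact: H.
have e16 : 0 < 16^-1 :> R by rewrite invr_gt0.
have [del del0 r_del] := r_unif _ e16.
(* The bound 1 keeps half of the perturbed map in the unit ball; the bound [del] keeps its
   retraction within 1/16 of [r (F / 2)]. *)
pose e := Num.min 1 del.
have e0 : 0 < e by rewrite lt_min ltr01.
have [e1 e_del] : e <= 1 /\ e <= del.
  by split; rewrite ge_min lexx ?orbT.
have [F' [F'c F'P]] := general_position qd Fc e0.
pose h u := frob (r (2^-1 *: F u)).
have F2 u : frob (2^-1 *: F u) <= 1 by rewrite half; have := F1 u; lra.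
have hc : continuous h.
  apply: continuous_compose (@continuous_frob R d d).
  apply: r_cont => //; apply: continuous_scale => //; exact: cst_continuous.
have h_UN u : UN R d (F u) -> h u = 2^-1.
  move=> [FN Fn]; rewrite /h r_id //; last exact: UN_scale.
  by rewrite half Fn mulr1.
(* The cutoff is 1 for h <= 1/8 and 0 for h >= 1/4, hence 0 at unit normal values, where h = 1/2. *)
pose lam u := clamp1 (2 - 8 * h u).
have lamc : continuous lam.
  apply: (@continuous_compose _ _ _ (fun u => 2 - 8 * h u)); last first.
    exact: continuous_clamp1.
  by move=> u; exact: (cvgB (cvg_cst _) (cvgM (cvg_cst _) (hc u))).
pose F2' u := F u + lam u *: (F' u - F u).
have F2'c : continuous F2'.
  by move=> u; exact: (cvgD (Fc u) (cvgZ (lamc u) (cvgB (F'c u) (Fc u)))).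
have F2'_close u : cube R q u -> frob (F2' u - F u) <= e.
  move=> /F'P[h1 _]; rewrite /F2' addrC addKr frobZ.
  have /andP[l0 l1] := clamp1_itv (2 - 8 * h u).
  rewrite ger0_norm //; apply: le_trans h1.
  by rewrite ler_piMl // frob_ge0.
have F2'_le u : cube R q u -> frob (2^-1 *: F2' u) <= 1.
  move=> /F2'_close h1; rewrite half.
  have := frobD (F2' u - F u) (F u); rewrite subrK; have := F1 u; lra.
have rF2'_neq0 u : cube R q u -> r (2^-1 *: F2' u) != 0.
  move=> uI; apply/eqP => rF0.
  (* For h >= 1/8 the retraction moves by at most 1/16 and stays nonzero; for h < 1/8 the
     perturbation acts fully and its value is not nilpotent. *)
  have [hu|hu] := lerP (8^-1) (h u).
    have : frob (r (2^-1 *: F2' u) - r (2^-1 *: F u)) <= 16^-1.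
      apply: r_del => //; first exact: F2'_le.
      by rewrite -scalerBr half; have := F2'_close u uI; lra.
    by rewrite rF0 sub0r frobN -/(h u); lra.
  have l1 : lam u = 1 by rewrite /lam clamp1_ge1 //; lra.
  have [_] := F'P u uI; apply.
  apply: (@char_poly_scale_nilpotent R d 2^-1); first by rewrite invr_eq0.
  apply: r0; first by have := F2'_le u uI; rewrite /F2' l1 scale1r subrKC.
  by move: rF0; rewrite /F2' l1 scale1r subrKC.
pose G u := 2^-1 *: F2' (clamp u).
have Gc : continuous G.
  apply: continuous_scale; first exact: cst_continuous.
  exact: continuous_compose (@continuous_clamp R q) F2'c.
have G1 u : frob (G u) <= 1 by exact/F2'_le/clamp_cube.
have rGc := r_cont G Gc G1.
have frG0 u : frob (r (G u)) != 0.
  apply/eqP => /frob_eq0 /eqP; apply/negP; exact/rF2'_neq0/clamp_cube.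
exists (fun u => (frob (r (G u)))^-1 *: r (G u)); split.
- have frc := continuous_compose rGc (@continuous_frob R d d).
  by apply: continuous_scale => // u; exact: (cvgV (frG0 u) (frc u)).
- move=> u; split; first exact/UN_scale/rN.
  by rewrite frobZ ger0_norm ?invr_ge0 ?frob_ge0 // mulVf.
- move=> u uI FU; have hu := h_UN u FU; case: (FU) => FN Fn.
  have -> : G u = 2^-1 *: F u.
    rewrite /G clamp_id // /F2' /lam hu clamp1_le0 ?scale0r ?addr0 //; lra.
  rewrite -/(h u) hu r_id //; last exact: UN_scale.
  by rewrite scalerA invrK mulfV // scale1r.
Qed.

(** By convexity the segment from [f] to [g] stays in the unit ball, and it is unit normal on the
    whole boundary of the (1 + k)-cube; [normal_extension] with q = 1 + k < d corrects the interior
    only. *)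
Lemma spheroids_homotopic k (x0 : set_type (UN R d)) f g : (k + 2 <= d)%N ->
  spheroid (R := R) (k := k) x0 f -> spheroid x0 g -> homotopic x0 f g.
Proof.
move=> kd [fc fb] [gc gb].
have val_cont : continuous (set_val : set_type (UN R d) -> 'M[R]_d).
  exact: initial_continuous.
have UNval (x : set_type (UN R d)) : UN R d (set_val x) by exact: set_valP.
pose fv s := set_val (f (clamp s)); pose gv s := set_val (g (clamp s)).
have fvc : continuous fv.
  exact: continuous_compose (continuous_comp_clamp fc) val_cont.
have gvc : continuous gv.
  exact: continuous_compose (continuous_comp_clamp gc) val_cont.
pose tc (u : 'rV[R]_(1 + k)) := clamp1 (u ord0 (lshift k ord0)).
have tcc : continuous tc.
  exact: continuous_compose (@coord_continuous _ _ _ _ _)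
    (@continuous_clamp1 R).
have rc : continuous (fun u : 'rV[R]_(1 + k) => rsubmx u).
  apply: continuous_mx => i j; under eq_fun do rewrite mxE.
  exact: coord_continuous.
pose F (u : 'rV[R]_(1 + k)) :=
  (1 - tc u) *: fv (rsubmx u) + tc u *: gv (rsubmx u).
have Fc : continuous F.
  have tcc' : continuous (fun u => 1 - tc u).
    by move=> u; exact: (cvgB (cvg_cst _) (tcc u)).
  have c1 := continuous_scale tcc' (continuous_compose rc fvc).
  have c2 := continuous_scale tcc (continuous_compose rc gvc).
  by move=> u; exact: (cvgD (c1 u) (c2 u)).
have F1 u : frob (F u) <= 1.
  have /andP[t0 t1] := clamp1_itv (u ord0 (lshift k ord0)).
  apply: le_trans (frobD _ _) _; rewrite !frobZ !ger0_norm ?subr_ge0 //.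
  have [_ ->] := UNval (f (clamp (rsubmx u))).
  have [_ ->] := UNval (g (clamp (rsubmx u))).
  by rewrite !mulr1 subrK.
have F0 u : tc u = 0 -> F u = fv (rsubmx u).
  by rewrite /F => ->; rewrite subr0 scale1r scale0r addr0.
have Ft1 u : tc u = 1 -> F u = gv (rsubmx u).
  by rewrite /F => ->; rewrite subrr scale1r scale0r add0r.
have Fb u : cube_boundary R k (rsubmx u) -> F u = set_val x0.
  move=> ub; have [uI _] := ub.
  by rewrite /F /fv /gv clamp_id // fb // gb // -scalerDl subrK scale1r.
have Fbd u : cube_boundary R (1 + k) u -> UN R d (F u).
  move=> [uI [i ui]]; have uI' : cube R k (rsubmx u).
    by move=> j; rewrite mxE; exact: uI.
  case: (fintype.splitP i) => [j ij|j ij].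
    have e : i = lshift k ord0 by apply/val_inj; rewrite /= ij ord1.
    rewrite e in ui; case: ui => ui.
      by rewrite F0; [exact: UNval | rewrite /tc ui clamp1_id // lexx ler01].
    by rewrite Ft1; [exact: UNval | rewrite /tc ui clamp1_id // lexx ler01].
  rewrite Fb; first exact: UNval.
  split=> //; exists j; rewrite mxE.
  by rewrite (_ : rshift 1 j = i) //; apply/val_inj; rewrite /= ij.
have [|N [Nc NU NF]] := normal_extension _ Fc F1 Fbd.
  by rewrite add1n -addn1 (leq_trans _ kd) // addn1 addn2.
have J (p : R * 'rV[R]_k) : N (row_mx p.1%:M p.2) \in UN R d.
  exact/mem_set/NU.
exists (fun p => SigSub (J p)).
have mkU t s : 0 <= t <= 1 -> cube R k s -> cube R (1 + k) (row_mx t%:M s).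
  move=> t01 sI i; rewrite mxE; case: fintype.splitP => j _; last exact: sI.
  by rewrite !ord1 mxE eqxx mulr1n.
have tcE t s : 0 <= t <= 1 -> tc (row_mx t%:M s) = t.
  by move=> t01; rewrite /tc row_mxEl mxE eqxx mulr1n clamp1_id.
split.
- apply: continuous_subspaceT; apply: continuous_comp_initial.
  rewrite [X in continuous X](_ : _ =
    (fun p : R * 'rV[R]_k => N (row_mx p.1%:M p.2))) //.
  apply: continuous_compose Nc; apply: continuous_mx => i j.
  case: (fintype.split_ordP j) => l ->.
    rewrite (_ : (fun _ => _) = fst); first exact: continuous_fst.
    by apply/funext => p; rewrite row_mxEl !ord1 mxE eqxx mulr1n.
  rewrite (_ : (fun _ => _) = (fun p : R * 'rV[R]_k => p.2 i l)); last first.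
    by apply/funext => p; rewrite row_mxEr.
  exact: continuous_compose (@continuous_snd _ _) (@coord_continuous _ _ _ _ _).
- move=> s sI; apply/val_inj => /=.
  have t01 : 0 <= (0 : R) <= 1 by rewrite lexx ler01.
  have E : F (row_mx 0%:M s) = val (f s).
    by rewrite F0 ?tcE // row_mxKr /fv clamp_id.
  by rewrite NF; [exact: E | exact: mkU | rewrite E; exact: UNval].
- move=> s sI; apply/val_inj => /=.
  have t01 : 0 <= (1 : R) <= 1 by rewrite lexx ler01.
  have E : F (row_mx 1%:M s) = val (g s).
    by rewrite Ft1 ?tcE // row_mxKr /gv clamp_id.
  by rewrite NF; [exact: E | exact: mkU | rewrite E; exact: UNval].
- move=> t s t01 sb; have [sI _] := sb; apply/val_inj => /=.
  have E : F (row_mx t%:M s) = val x0 by rewrite Fb // row_mxKr.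
  by rewrite NF; [exact: E | exact: mkU | rewrite E; exact: UNval].
Qed.
End Homotopy.

Theorem theorem3p13 (R : realType) (d : nat) (hd : (1 <= d)%N)
    (k : nat) (hk : (k + 2 <= d)%N) :
  k_connected R k (set_type (UN R d)).
Proof.
move=> x0.
have cst_spheroid : spheroid (R := R) (k := k) x0 (fun=> x0).
  by split=> //; apply: continuous_subspaceT; exact: cst_continuous.
(* Any two spheroids are homotopic, so each class is the whole set of spheroids and there is a
   single class. *)
have classE f : spheroid (R := R) (k := k) x0 f ->
    homotopy_class x0 f = spheroid x0.
  move=> fS; apply/seteqP; split=> g; first by case.
  by move=> gS; split=> //; exact: spheroids_homotopic.
rewrite /pi_trivial /pi_; apply/seteqP; split=> [_ [f fS <-]|_ ->] /=.
  by rewrite !classE.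
by exists (fun=> x0).
Qed.
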